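(* Let $N\ge 2$. There is a constant $C$, not depending on $f$, $\lambda$ or $I$, such that for every $\lambda\ge 1$, every $f\in L^2(\mathbb{R}^N)$ with $\operatorname{supp}\hat f\subset\{\xi:|\xi|\sim\lambda\}$, and every interval $I\subset\mathbb{R}$ with $\lambda^{-2}\le|I|\le\lambda^{-1}$, $$\Bigl\|\sup_{t\in I}|e^{itL}f(x)|\Bigr\|_{L^2(B(0,1))}\le C\,\lambda\,|I|^{\frac12}\,\|f\|_{L^2}.$$
   Context: For $t\in\mathbb{R}$, $e^{itL}f(x)=\int_{\mathbb{R}^N}e^{ix\cdot\xi+it(\xi_1^2-\xi_2^2\pm\cdots\pm\xi_N^2)}\hat f(\xi)\,d\xi$, for any fixed choice of the signs $\pm$ of $\xi_3^2,\dots,\xi_N^2$, with $\hat f$ the Fourier transform of $f$ (normalized so that $t=0$ gives $f$). $B(0,1)$ is the unit ball of $\mathbb{R}^N$ centered at the origin, and $|I|$ is the length of $I$. $|\xi|\sim\lambda$ means $c_1\lambda\le|\xi|\le c_2\lambda$ for fixed absolute constants $0<c_1<c_2$ (the constant $C$ may depend on $N$, $c_1$, $c_2$). *)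

(* Defs.v *)
From HB Require Import structures.
From mathcomp Require Import all_boot all_order all_algebra.
From mathcomp Require Import complex.
From mathcomp Require Import all_classical all_reals all_analysis.

Set Implicit Arguments.
Unset Strict Implicit.
Unset Printing Implicit Defensive.
Import Order.TTheory GRing.Theory Num.Theory.
Import numFieldNormedType.Exports.
Import Normc.

Local Open Scope classical_set_scope.
Local Open Scope complex_scope.
Local Open Scope ring_scope.

(* The library equips tuples with the sigma-algebra generated by the
   coordinates: the measurable subsets of 'R^(R, N) are the Borel sets. *)
Notation "''R^' ( R , N )" := (N.-tuple (measurableTypeR R))
  (at level 8, R at level 50, N at level 50, format "''R^' ( R ,  N )")
  : type_scope.

Section cons_measure.
Context {R : realType} {N : nat}.
Local Open Scope ereal_scope.

Definition tcons (p : measurableTypeR R * 'R^(R, N)) : 'R^(R, N.+1) :=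
  [tuple of p.1 :: p.2].

Lemma measurable_tcons : measurable_fun setT tcons.
Proof. exact: measurable_cons. Qed.

Variable m : {sigma_finite_measure set 'R^(R, N) -> \bar R}.

Definition cons_measure : set 'R^(R, N.+1) -> \bar R :=
  pushforward (@lebesgue_measure R \x m) tcons.

HB.instance Definition _ := Measure.copy cons_measure
  (measure_function_pushforward__canonical__measure_function_Measure
     (@lebesgue_measure R \x m) measurable_tcons).

Let cons_measure_sigma_finite : sigma_finite setT cons_measure.
Proof.
have /sigma_finiteP[F [FT ndF Foo]] :=
  sigma_finiteT (lebesgue_stieltjes_measure (@idfun R)).
have /sigma_finiteP[G [GT ndG Goo]] := sigma_finiteT m.
exists (fun n => [set x : 'R^(R, N.+1) | F n (thead x) /\
                                         G n [tuple of behead x]]).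
  apply/seteqP; split=> // x _.
  have [i _ Fi] : (\bigcup_i F i) (thead x) by rewrite -FT.
  have [j _ Gj] : (\bigcup_i G i) [tuple of behead x] by rewrite -GT.
  exists (maxn i j) => //=; split.
    by apply: (subsetPset _ _ (ndF _ _ (leq_maxl i j))).
  by apply: (subsetPset _ _ (ndG _ _ (leq_maxr i j))).
move=> n; have [mF Fn] := Foo n; have [mG Gn] := Goo n; split.
  apply: measurableI.
    have := @measurable_tnth _ (measurableTypeR R) N.+1 ord0.
    by move=> /(_ measurableT _ mF); rewrite setTI.
  have := @measurable_behead _ (measurableTypeR R) N.
  by move=> /(_ measurableT _ mG); rewrite setTI.
rewrite /cons_measure /pushforward [X in (_ \x _) X](_ : _ = F n `*` G n).
  by rewrite product_measure1E// lte_mul_pinfty// ge0_fin_numE.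
have E a (x : 'R^(R, N)) : G n [tuple of behead (tcons (a, x))] = G n x.
  by congr (G n _); exact: val_inj.
apply/seteqP; split=> -[a x] [Fa Gx]; split=> //.
  by move: Gx; rewrite E.
by rewrite -(E a) in Gx.
Qed.

HB.instance Definition _ := Measure_isSigmaFinite.Build _ _ _ cons_measure
  cons_measure_sigma_finite.
End cons_measure.

Fixpoint lebesgue_Rn (R : realType) (N : nat) :
    {sigma_finite_measure set 'R^(R, N) -> \bar R} :=
  match N with
  | 0 => \d_([tuple] : 'R^(R, 0))
  | N'.+1 => cons_measure (lebesgue_Rn R N')
  end.

Lemma lebesgue_Rn_box (R : realType) (N : nat)
    (A : 'I_N -> set (measurableTypeR R)) :
  (forall i, measurable (A i)) ->
  lebesgue_Rn R N [set x | forall i, A i (tnth x i)] =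
  (\prod_(i < N) lebesgue_measure (A i))%E.
Proof.
elim: N A => [|N IH] A mA.
  by rewrite big_ord0 /= diracE mem_set// => -[].
rewrite big_ord_recl -(IH (fun i => A (lift ord0 i)))//=.
rewrite /cons_measure /pushforward -product_measure1E//; last first.
  rewrite (_ : mkset _ = \bigcap_(i in [set: 'I_N])
      ((fun x : 'R^(R, N) => tnth x i) @^-1` A (lift ord0 i))); last first.
    by apply/seteqP; split=> x /= h i => [_|]; exact: h.
  apply: fin_bigcap_measurable => // i _.
  by rewrite -[X in measurable X]setTI; exact: measurable_tnth.
congr (_ _); apply/seteqP; split => -[a x] /=.
  move=> h; split; first exact: (h ord0).
  by move=> i; have := h (lift ord0 i); rewrite tnthS.
move=> [Aa h] i; case: (unliftP ord0 i) => [j ->|->//].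
by rewrite tnthS; exact: h.
Qed.

Section schrodinger.
Context {R : realType} {N : nat}.
Local Notation mu := (lebesgue_Rn R N).
Implicit Types (x xi : 'R^(R, N)) (f g : 'R^(R, N) -> R[i]).

Definition dotp x xi : R := \sum_(i < N) tnth x i * tnth xi i.

Definition eunorm x : R := Num.sqrt (\sum_(i < N) tnth x i ^+ 2).

Definition eudist x xi : R := Num.sqrt (\sum_(i < N) (tnth x i - tnth xi i) ^+ 2).

Definition oball (r : R) : set 'R^(R, N) := [set x | eunorm x < r].

Definition cis (theta : R) : R[i] := cos theta +i* sin theta.

(* The library integral is real-valued, so complex integrals are taken
   componentwise. *)
Definition cintegral (D : set 'R^(R, N)) f : R[i] :=
  (\int[mu]_(x in D) complex.Re (f x)) +i* (\int[mu]_(x in D) complex.Im (f x)).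

Definition L2norm f : \bar R := 'N[mu]_2%:E[(fun x => (normc (f x))%:E)].

Definition memL2 f : Prop :=
  [/\ measurable_fun setT (fun x => complex.Re (f x)),
      measurable_fun setT (fun x => complex.Im (f x))
    & (L2norm f < +oo)%E].

(* (2 pi)^-N times the integral over D of exp (- i x.xi) f x: the factor puts
   the normalization on this side, so that Fourier inversion has constant 1. *)
Definition fourier_integral (D : set 'R^(R, N)) f xi : R[i] :=
  ((2 * pi) ^- N)%:C * cintegral D (fun x => cis (- dotp x xi) * f x).

(* g represents the (Plancherel) Fourier transform of f in L^2: the truncations
   of f to balls are integrable, and their transforms converge to g in L^2. *)
Definition is_fourier_transform f g : Prop :=
  memL2 g /\
  L2norm (fun xi => g xi - fourier_integral (oball r) f xi) @[r --> +oo] --> 0%E.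

(* The support of a function defined up to null sets. *)
Definition esupport g : set 'R^(R, N) :=
  [set xi | forall r : R, 0 < r ->
    ~ {ae mu, forall eta, eudist xi eta < r -> g eta = 0}].

(* s i = true stands for a minus sign in front of xi_i ^ 2; the first two signs
   are + and -, the remaining ones are arbitrary. *)
Definition admissible_signs (s : 'I_N -> bool) : Prop :=
  forall i : 'I_N, (i = 0%N :> nat -> s i = false) /\
                   (i = 1%N :> nat -> s i = true).

Definition symbol (s : 'I_N -> bool) xi : R :=
  \sum_(i < N) (-1) ^+ s i * tnth xi i ^+ 2.

(* exp (i t L) f, in terms of a Fourier transform fhat of f *)
Definition eitL (s : 'I_N -> bool) (fhat : 'R^(R, N) -> R[i]) (t : R) x : R[i] :=
  cintegral setT (fun xi => cis (dotp x xi + t * symbol s xi) * fhat xi).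

End schrodinger.

(* Main.v *)
(* Write F(t) = exp(itL) f and L = c2^2 lambda^2, a bound for the phase on the
   support of fhat. Integrating d/dt of F^2 from a fixed time t0 of I gives
     sup_I |F|^2 <= |F(t0)|^2 + int_I (lambda^2 |F|^2 + lambda^-2 |dF/dt|^2) dt
   pointwise in x. Integrating over the whole space, with |F(t)|_2 <= C |f|_2 and
   |dF/dt|_2 <= C L |f|_2, bounds the right-hand side by
   C (1 + lambda^2 |I|) |f|_2^2, and 1 <= lambda^2 |I|.

   The L^2 bounds come from a Plancherel inequality, applied once to fhat and
   once to F(t). For real integrable h, insert the Abel weight
   exp(- e (|xi_1| + ... + |xi_N|)) into the integral of |hhat|^2: by Fubini it
   becomes the quadratic form of h with the Poisson kernel, the product of the
   2 e / (e^2 + (x_i - y_i)^2), which is nonnegative and has integral (2 pi)^N in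
   each variable, so Schur's test applies; then e tends to 0. *)
Require Import Defs.
From mathcomp Require Import all_boot all_order all_algebra.
From mathcomp Require Import complex ring lra.
From mathcomp Require Import all_classical all_reals all_analysis.
From mathcomp Require Import measurable_realfun.

Set Implicit Arguments.
Unset Strict Implicit.
Unset Printing Implicit Defensive.
Import Order.TTheory GRing.Theory Num.Theory.
Import numFieldNormedType.Exports.

Local Open Scope classical_set_scope.
Local Open Scope ring_scope.

(** * The one-dimensional Abel weight and Poisson kernel *)

Section kernel1.
Context {R : realType}.
Local Notation leb := (@lebesgue_measure R).
Implicit Types e x xi : R.

(** The weight exp(- e |xi|) is convenient because everything about it is elementary: it has an
    explicit primitive against the cosine, its transform is a rational function that integrates to
    an arctangent, and it increases to 1 as e decreases to 0, so the limit is a monotone one.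
    Products of one-dimensional kernels carry this to R^N by induction. Only upper bounds enter, so
    a one-sided Plancherel inequality with a lossy constant is enough; factors 2 are lost wherever a
    complex quantity is split into real ones. The support condition acts twice. It bounds the phase,
    and since a ball has finite measure it puts fhat in L^1, so that exp(itL) f is an absolutely
    convergent integral, differentiable in t under the integral sign at every x. The weights
    lambda^2 and lambda^-2 are balanced: with k = lambda^2 and L of size lambda^2, both k and L^2 /
    k have size lambda^2. The supremum over uncountably many times is dominated by a measurable
    majorant; comparing the two uses only that integrals of nonnegative functions are monotone. *)

Definition abel1 e xi : R := expR (- (e * `|xi|)).

Definition poisson1 e x : R := 2 * e / (e ^+ 2 + x ^+ 2).

Lemma abel1_ge0 e xi : 0 <= abel1 e xi.
Proof. exact: expR_ge0. Qed.

Lemma poisson1_ge0 e x : 0 < e -> 0 <= poisson1 e x.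
Proof.
by move=> e0; rewrite divr_ge0 ?addr_ge0 ?sqr_ge0// mulr_ge0// ltW.
Qed.

Lemma continuous_abel1 e : continuous (abel1 e).
Proof.
move=> x; apply: (@continuous_comp _ _ _ (fun x => - (e * `|x|)) expR).
  by apply: cvgN; apply: cvgM; [exact: cvg_cst|exact: norm_continuous].
exact: continuous_expR.
Qed.

(* The library's fundamental theorem of calculus on a half-line needs a
   nonnegative integrand, hence the summand 1 next to the cosine. *)
Lemma integral_abel1_cos e x (c : bool) : 0 < e ->
  (\int[leb]_xi (abel1 e xi * (1 + c%:R * cos (x * xi)))%:E =
   (2 / e + c%:R * poisson1 e x)%:E)%E.
Proof.
move=> e0.
have cf : continuous (fun xi : R => abel1 e xi * (1 + c%:R * cos (x * xi))).
  move=> y; apply: cvgM; first exact: continuous_abel1.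
  apply: cvgD; first exact: cvg_cst.
  apply: cvgM; first exact: cvg_cst.
  apply: (@continuous_comp _ _ _ (fun y => x * y) cos).
    by apply: cvgM; [exact: cvg_cst|exact: cvg_id].
  exact: continuous_cos.
have f0 xi : 0 <= abel1 e xi * (1 + c%:R * cos (x * xi)).
  rewrite mulr_ge0 ?abel1_ge0//; case: c {cf} => /=; last by rewrite mul0r addr0.
  by rewrite mul1r -lerBlDl sub0r cos_geN1.
rewrite ge0_symfun_integralT//=; last first.
  by move=> y /=; rewrite /abel1 normrN mulrN cosN.
have -> : [set t : R | 0 <= t] = `[0, +oo[%classic.
  by apply/seteqP; split => t/=; rewrite in_itv/= andbT.
have d0 : e ^+ 2 + x ^+ 2 != 0.
  by rewrite gt_eqF// ltr_pwDl ?sqr_ge0// exprn_gt0.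
(* A primitive on the half-line; its cosine part is the real part of exp((i x - e) t) / (i x -
   e). *)
pose A (t : R) := expR (- (e * t)) *
  (- e^-1 + c%:R * ((x * sin (x * t) - e * cos (x * t)) / (e ^+ 2 + x ^+ 2))).
have dA (t : R) : is_derive t (1 : R) A (expR (- (e * t)) * (1 + c%:R * cos (x * t))).
  rewrite /A; apply: is_derive_eq.
  rewrite /GRing.scale/=.
  by field; rewrite d0 gt_eqF.
have cA : continuous A.
  by move=> t; apply/differentiable_continuous/derivable1_diffP; have [] := dA t.
have Ay : A t @[t --> +oo] --> 0.
  pose M := e^-1 + (`|x| + e) / (e ^+ 2 + x ^+ 2).
  apply: norm_cvg0.
  have cM : expR (- (e * t)) * M @[t --> +oo] --> 0.
    rewrite -(mul0r M); apply: cvgM; last exact: cvg_cst.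
    apply: (cvg_comp (fun t => e * t) (fun t => expR (- t))).
      by apply: gt0_cvgMry => //; exact: cvg_id.
    exact: cvgr_expR.
  apply: (@squeeze_cvgr _ _ _ _ (cst 0) _ _ _ _ _ cM); last exact: cvg_cst.
  apply: nearW => t /=; rewrite normr_ge0/= normrM ger0_norm ?expR_ge0//.
  rewrite ler_wpM2l ?expR_ge0//.
  rewrite (le_trans (ler_normD _ _))// normrN ger0_norm ?invr_ge0 ?(ltW e0)//.
  rewrite lerD2l normrM.
  have -> : `|c%:R| = c%:R :> R by rewrite ger0_norm.
  apply: (@le_trans _ _ (1 * `|(x * sin (x * t) - e * cos (x * t)) / (e ^+ 2 + x ^+ 2)|)).
    by rewrite ler_wpM2r//; case: (c).
  rewrite mul1r normrM normfV ler_pM ?invr_ge0//.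
    rewrite (le_trans (ler_normB _ _))// !normrM lerD//.
      by rewrite ler_piMr// sin_max.
    by rewrite (ger0_norm (ltW e0)) ler_piMr ?(ltW e0)// cos_max.
  by rewrite ger0_norm// addr_ge0 ?sqr_ge0.
rewrite (@ge0_continuous_FTC2y _ _ A 0 0)//.
- rewrite sub0e /A mulr0 oppr0 expR0 mul1r mulr0 sin0 cos0 mulr0 mulr1 sub0r.
  rewrite -EFinN -EFinM; congr EFin; rewrite /poisson1.
  by field; rewrite d0 gt_eqF.
- by apply: continuous_subspaceT.
- by apply: cvg_at_right_filter; exact: cA.
- move=> t; rewrite in_itv/= andbT => t0; rewrite derive1E.
  by have [_ ->] := dA t; rewrite /abel1 gtr0_norm.
Qed.

Lemma integrable_abel1 e : 0 < e -> leb.-integrable setT (EFin \o abel1 e).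
Proof.
move=> e0; apply/integrableP; split.
  by apply/measurable_EFinP; apply: continuous_measurable_fun; exact: continuous_abel1.
have := integral_abel1_cos 0 false e0; rewrite mul0r addr0 => H.
rewrite (_ : integral _ _ _ = (2 / e)%:E) ?ltry// -H; apply: eq_integral => x _ /=.
by rewrite mul0r addr0 mulr1 ger0_norm// abel1_ge0.
Qed.

Lemma integrable_abel1M e (g : R -> R) : 0 < e -> measurable_fun setT g ->
  (forall x, `|g x| <= 1) -> leb.-integrable setT (fun x => (abel1 e x * g x)%:E).
Proof.
move=> e0 mg g1; apply: le_integrable (integrable_abel1 e0) => //.
  apply/measurable_EFinP/measurable_funM => //.
  apply: continuous_measurable_fun; exact: continuous_abel1.
by move=> x _; rewrite lee_fin normrM ler_piMr.
Qed.

Lemma abel1_cos e x : 0 < e ->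
  (\int[leb]_xi (abel1 e xi * cos (x * xi)) = poisson1 e x)%R.
Proof.
move=> e0.
have mc : measurable_fun setT (fun xi : R => cos (x * xi)).
  apply: continuous_measurable_fun => y.
  apply: (@continuous_comp _ _ _ (fun y => x * y) cos).
    by apply: cvgM; [exact: cvg_cst|exact: cvg_id].
  exact: continuous_cos.
have c1 xi : `|cos (x * xi)| <= 1 by rewrite cos_max.
have H0 : \int[leb]_xi abel1 e xi = 2 / e.
  rewrite /Rintegral.
  have := integral_abel1_cos x false e0; rewrite mul0r addr0 => H.
  rewrite (_ : 2 / e = fine (2 / e)%:E)// -H; congr fine.
  by apply: eq_integral => t _; rewrite mul0r addr0 mulr1.
have := integral_abel1_cos x true e0; rewrite mul1r => H.
(* The case [c = true] minus the case [c = false] isolates the cosine integral. *)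
have : \int[leb]_xi (abel1 e xi + abel1 e xi * cos (x * xi)) = 2 / e + poisson1 e x.
  rewrite (_ : 2 / e + _ = fine (2 / e + poisson1 e x)%:E)// -H; congr fine.
  by apply: eq_integral => t _; rewrite mul1r mulrDr mulr1.
rewrite RintegralD//; [|exact: integrable_abel1|exact: integrable_abel1M].
by rewrite H0 => /addrI.
Qed.

(** The integrand is odd, so invariance of Lebesgue measure under [-%R] gives [I = - I]. *)
Lemma abel1_sin e x : 0 < e ->
  (\int[leb]_xi (abel1 e xi * sin (x * xi)) = 0)%R.
Proof.
move=> e0.
have ms : measurable_fun setT (fun xi : R => sin (x * xi)).
  apply: continuous_measurable_fun => y.
  apply: (@continuous_comp _ _ _ (fun y => x * y) sin).
    by apply: cvgM; [exact: cvg_cst|exact: cvg_id].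
  exact: continuous_sin.
have s1 xi : `|sin (x * xi)| <= 1 by rewrite sin_max.
have iS := integrable_abel1M e0 ms s1.
set I := (X in X = 0).
have : I = - I.
  rewrite {1}/I /Rintegral.
  have mN : measurable_fun [set: measurableTypeR R] (-%R : _ -> measurableTypeR R).
    apply: continuous_measurable_fun; exact: opp_continuous.
  rewrite (@eq_measure_integral _ _ _ setT
    (pushforward leb (-%R : measurableTypeR R -> measurableTypeR R))); last first.
    by move=> A mA _; apply/esym/lebesgue_measureN.
  rewrite integral_pushforward//=; last 2 first.
    exact: measurable_int iS.
    have := iS; rewrite preimage_setT; apply: le_integrable => //.
      by apply: measurableT_comp mN; exact: measurable_int iS.
    by move=> t _; rewrite /= /abel1 normrN mulrN sinN mulrN normrN.
  rewrite preimage_setT -mulN1r -RintegralZl//; congr fine.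
  by apply: eq_integral => t _; rewrite /= /abel1 normrN mulrN sinN mulrN mulN1r.
by move/eqP; rewrite -subr_eq0 opprK -mulr2n mulrn_eq0/= => /eqP.
Qed.

(** The substitution u = (y - x) / e turns the integrand into 2 / (1 + u^2), an even function whose
    half-line integral is pi. *)
Lemma integral_poisson1 e x : 0 < e ->
  (\int[leb]_y (poisson1 e (x - y))%:E = (2 * pi)%:E)%E.
Proof.
move=> e0.
have H : (\int[leb]_u (2 / oneDsqr u)%:E = (2 * pi)%:E)%E.
  rewrite ge0_symfun_integralT//=; last first.
  - by move=> t /=; rewrite /oneDsqr sqrrN.
  - move=> y; apply: cvgM; first exact: cvg_cst.
    exact: continuous_oneDsqrV.
  - have -> : [set t : R | 0 <= t] = `[0, +oo[%classic.
      by apply/seteqP; split => t/=; rewrite in_itv/= andbT.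
  under eq_integral do rewrite EFinM.
  rewrite ge0_integralZl//=.
  + rewrite integral0y_oneDsqr -!EFinM; congr EFin; field.
  + by [].
  + apply/measurable_EFinP/measurable_funTS; apply: continuous_measurable_fun.
    exact: continuous_oneDsqrV.
pose F (y : R) := e^-1 * (y - x).
have dF (y : R) : is_derive y (1 : R) F e^-1.
  by rewrite /F; apply: is_derive_eq; rewrite /GRing.scale/=; ring.
have dFE : F^`()%classic = cst e^-1.
  by apply/funext => y; rewrite derive1E; have [_ ->] := dF y.
rewrite -H (@increasing_ge0_integration_by_substitutionT _ F (fun u => 2 / oneDsqr u)).
- apply: eq_integral => y _; rewrite dFE /=; congr EFin.
  rewrite /GRing.mul/= -/(GRing.mul _ _) /poisson1 /oneDsqr /F.
  have ? : e ^+ 2 + (x - y) ^+ 2 != 0.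
    by rewrite gt_eqF// ltr_pwDl ?sqr_ge0// exprn_gt0.
  have ? : e ^+ 2 + (y - x) ^+ 2 != 0.
    by rewrite gt_eqF// ltr_pwDl ?sqr_ge0// exprn_gt0.
  rewrite -[RHS]/(2 / (1 + (e^-1 * (y - x)) ^+ 2) * e^-1).
  have -> : 1 + (e^-1 * (y - x)) ^+ 2 = (e ^+ 2 + (y - x) ^+ 2) / e ^+ 2.
    by field; rewrite gt_eqF.
  by field; apply/andP; split => //; rewrite gt_eqF.
- by move=> a b ab; rewrite /F ltr_pM2l ?invr_gt0// ltrD2r.
- by rewrite dFE => ?; exact: cvg_cst.
- by rewrite dFE; apply/cvg_ex; exists e^-1; exact: cvg_cst.
- by rewrite dFE; apply/cvg_ex; exists e^-1; exact: cvg_cst.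
- by move=> y; have [] := dF y.
- apply/cvgrNyPle => M; near=> y;
  rewrite /F mulrC ler_pdivrMr// lerBlDr.
  by near: y; apply: nbhs_ninfty_le; rewrite num_real.
- apply/cvgryPge => M; near=> y.
  rewrite /F mulrC ler_pdivlMr// lerBrDr.
  by near: y; apply: nbhs_pinfty_ge; rewrite num_real.
- move=> y; apply: cvgM; first exact: cvg_cst.
  exact: continuous_oneDsqrV.
- by move=> y; rewrite divr_ge0// (le_trans _ (oneDsqr_ge1 _)).
Unshelve. all: by end_near. Qed.

End kernel1.

(** * Tensor products of integrable functions *)

Section tensor.
Context d1 d2 (T1 : measurableType d1) (T2 : measurableType d2) (R : realType).
Variables (m1 : {sigma_finite_measure set T1 -> \bar R})
  (m2 : {sigma_finite_measure set T2 -> \bar R}).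
Variables (u : T1 -> R) (v : T2 -> R).
Hypotheses (iu : m1.-integrable setT (EFin \o u))
  (iv : m2.-integrable setT (EFin \o v)).
Local Open Scope ereal_scope.

Let mu1 : measurable_fun setT u.
Proof. by apply/measurable_EFinP; exact: measurable_int iu. Qed.

Let mv2 : measurable_fun setT v.
Proof. by apply/measurable_EFinP; exact: measurable_int iv. Qed.

Lemma measurable_tensor : measurable_fun setT (fun z : T1 * T2 => (u z.1 * v z.2)%R).
Proof. by apply: measurable_funM; exact: measurableT_comp. Qed.

Lemma integrable_tensor :
  (m1 \x m2).-integrable setT (fun z => (u z.1 * v z.2)%:E).
Proof.
apply/integrable12ltyP; first by apply/measurable_EFinP; exact: measurable_tensor.
have /integrableP[_ fu] := iu; have /integrableP[_ fv] := iv.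
have V0 : 0 <= \int[m2]_x `|(v x)%:E| by exact: integral_ge0.
rewrite (_ : integral _ _ _ = \int[m1]_x `|(u x)%:E| * \int[m2]_x `|(v x)%:E|).
  by rewrite lte_mul_pinfty// ?ge0_fin_numE// integral_ge0.
rewrite -ge0_integralZr//; last by do 2 apply: measurableT_comp => //.
apply: eq_integral => x _ /=.
rewrite -ge0_integralZl//; last by do 2 apply: measurableT_comp => //.
by apply: eq_integral => y _; rewrite normrM.
Qed.

Lemma Rintegral_tensor :
  (\int[m1 \x m2]_z (u z.1 * v z.2) = \int[m1]_x u x * \int[m2]_x v x)%R.
Proof.
rewrite {1}/Rintegral -integral12_prod_meas1; last exact: integrable_tensor.
rewrite (_ : integral _ _ _ = \int[m1]_x ((u x)%:E * \int[m2]_x (v x)%:E)).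
  by rewrite -[in LHS](fineK (integrable_fin_num measurableT iv)) integralZr//
    fineM//; exact: integrable_fin_num.
by apply: eq_integral => x _ /=; rewrite /fubini_F/= -integralZl.
Qed.

End tensor.

(** * Abel weight and Poisson kernel on R^N *)

Section Rn.
Context {R : realType}.
Local Notation leb := (@lebesgue_measure R).
Local Notation mu N := (lebesgue_Rn R N).

Local Arguments lebesgue_Rn : simpl never.

Definition tbehead N (x : 'R^(R, N.+1)) : 'R^(R, N) := [tuple of behead x].

Lemma tbeheadE N (p : measurableTypeR R * 'R^(R, N)) : tbehead (tcons p) = p.2.
Proof. by apply: val_inj. Qed.

Lemma measurable_thead N : measurable_fun setT (@thead N (measurableTypeR R)).
Proof. exact: measurable_tnth. Qed.

Lemma measurable_tbehead N : measurable_fun setT (@tbehead N).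
Proof. exact: measurable_behead. Qed.

Lemma tnth_tbehead N (x : 'R^(R, N.+1)) i : tnth (tbehead x) i = tnth x (lift ord0 i).
Proof. by rewrite !(tnth_nth 0)/= nth_behead. Qed.

Lemma ge0_integral_RnS N (f : 'R^(R, N.+1) -> \bar R) :
  measurable_fun setT f -> (forall x, 0 <= f x)%E ->
  (\int[mu N.+1]_x f x = \int[leb]_a \int[mu N]_x f (tcons (a, x)))%E.
Proof.
move=> mf f0.
rewrite -(fubini_tonelli1 (f \o @tcons R N)).
  by rewrite ge0_integral_pushforward//; exact: measurable_tcons.
  exact: (measurableT_comp mf measurable_tcons).
by move=> x /=; exact: f0.
Qed.

Lemma integrable_tensor_Rn N (u : measurableTypeR R -> R) (v : 'R^(R, N) -> R) :
  leb.-integrable setT (EFin \o u) -> (mu N).-integrable setT (EFin \o v) ->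
  (mu N.+1).-integrable setT (fun x => (u (thead x) * v (tbehead x))%:E).
Proof.
move=> iu iv; apply: integrable_pushforward => //.
- exact: measurable_tcons.
- apply/measurable_EFinP; apply: measurable_funM.
    apply: (measurableT_comp _ (@measurable_thead _)).
    by apply/measurable_EFinP; exact: measurable_int iu.
  apply: (measurableT_comp _ (@measurable_tbehead _)).
  by apply/measurable_EFinP; exact: measurable_int iv.
- rewrite preimage_setT; apply: eq_integrable (integrable_tensor iu iv) => //.
  by move=> z _ /=; rewrite tbeheadE.
Qed.

Lemma Rintegral_tensor_Rn N (u : measurableTypeR R -> R) (v : 'R^(R, N) -> R) :
  leb.-integrable setT (EFin \o u) -> (mu N).-integrable setT (EFin \o v) ->
  \int[mu N.+1]_x (u (thead x) * v (tbehead x)) =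
  (\int[leb]_x u x) * \int[mu N]_x v x.
Proof.
move=> iu iv; rewrite -Rintegral_tensor// /Rintegral integral_pushforward//.
- by rewrite preimage_setT; congr fine; apply: eq_integral => z _ /=; rewrite tbeheadE.
- exact: measurable_tcons.
- exact: (measurable_int (mu N.+1) (integrable_tensor_Rn iu iv)).
- rewrite preimage_setT; apply: eq_integrable (integrable_tensor iu iv) => //.
  by move=> z _ /=; rewrite tbeheadE.
Qed.

Lemma measurable_cosR : measurable_fun setT (@cos R).
Proof. by apply: continuous_measurable_fun; exact: continuous_cos. Qed.

Lemma measurable_sinR : measurable_fun setT (@sin R).
Proof. by apply: continuous_measurable_fun; exact: continuous_sin. Qed.

Definition abel N (e : R) (xi : 'R^(R, N)) : R := \prod_(i < N) abel1 e (tnth xi i).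

(** The coefficients form a function on indices, so that passing to the tail in an induction on [N]
    is composition with [lift ord0]. *)
Definition lform N (c : 'I_N -> R) (xi : 'R^(R, N)) : R := \sum_(i < N) c i * tnth xi i.

Lemma abel_ge0 N e (xi : 'R^(R, N)) : 0 <= abel e xi.
Proof. by apply: prodr_ge0 => i _; exact: abel1_ge0. Qed.

Lemma abelS N e (xi : 'R^(R, N.+1)) :
  abel e xi = abel1 e (thead xi) * abel e (tbehead xi).
Proof.
rewrite /abel big_ord_recl; congr (_ * _).
by apply: eq_bigr => i _; rewrite tnth_tbehead.
Qed.

Lemma lformS N c (xi : 'R^(R, N.+1)) :
  lform c xi = c ord0 * thead xi + lform (fun i => c (lift ord0 i)) (tbehead xi).
Proof.
rewrite /lform big_ord_recl; congr (_ + _).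
by apply: eq_bigr => i _; rewrite tnth_tbehead.
Qed.

Lemma measurable_tnthR N (i : 'I_N) :
  measurable_fun setT (fun x : 'R^(R, N) => tnth x i : R).
Proof. exact: measurable_tnth. Qed.

Lemma measurable_lform N (c : 'I_N -> R) : measurable_fun setT (lform c).
Proof.
apply: measurable_sum => i; apply: measurable_funM => //.
exact: measurable_tnthR.
Qed.

Lemma measurable_abel N (e : R) : measurable_fun setT (@abel N e).
Proof.
apply: measurable_prod => i _; apply: measurableT_comp (measurable_tnthR i).
by apply: continuous_measurable_fun; exact: continuous_abel1.
Qed.

Lemma integrable_abelM_bounded N e (g : 'R^(R, N) -> R) :
  (mu N).-integrable setT (EFin \o @abel N e) -> measurable_fun setT g ->
  (forall x, `|g x| <= 1) -> (mu N).-integrable setT (fun x => (abel e x * g x)%:E).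
Proof.
move=> ia mg g1; apply: le_integrable (ia) => //.
  apply/measurable_EFinP; apply: measurable_funM => //.
  exact: measurable_abel.
by move=> x _; rewrite lee_fin normrM ler_piMr.
Qed.

Lemma integrable_abel N e : 0 < e -> (mu N).-integrable setT (EFin \o @abel N e).
Proof.
move=> e0; elim: N => [|N IH].
  apply/integrableP; split; first by apply/measurable_EFinP; exact: measurable_abel.
  rewrite integral_dirac//; last first.
    by apply: measurableT_comp => //; apply/measurable_EFinP; exact: measurable_abel.
  by rewrite diracT mul1e /= ltry.
apply: eq_integrable (integrable_tensor_Rn (integrable_abel1 e0) IH) => //.
by move=> x _; rewrite /= abelS.
Qed.

Lemma integrable_abel_cos N e (c : 'I_N -> R) : 0 < e ->
  (mu N).-integrable setT (fun x => (abel e x * cos (lform c x))%:E).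
Proof.
move=> e0; apply: integrable_abelM_bounded; first exact: integrable_abel.
  by apply: measurableT_comp (measurable_lform c) => //; exact: measurable_cosR.
by move=> x; exact: cos_max.
Qed.

Lemma integrable_abel_sin N e (c : 'I_N -> R) : 0 < e ->
  (mu N).-integrable setT (fun x => (abel e x * sin (lform c x))%:E).
Proof.
move=> e0; apply: integrable_abelM_bounded; first exact: integrable_abel.
  by apply: measurableT_comp (measurable_lform c) => //; exact: measurable_sinR.
by move=> x; exact: sin_max.
Qed.

Lemma integrable_abel1_cos e c : 0 < e ->
  leb.-integrable setT (fun x => (abel1 e x * cos (c * x))%:E).
Proof.
move=> e0; apply: integrable_abel1M => //.
  by apply: measurableT_comp => //; exact: measurable_cosR.
by move=> x; exact: cos_max.
Qed.

Lemma integrable_abel1_sin e c : 0 < e ->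
  leb.-integrable setT (fun x => (abel1 e x * sin (c * x))%:E).
Proof.
move=> e0; apply: integrable_abel1M => //.
  by apply: measurableT_comp => //; exact: measurable_sinR.
by move=> x; exact: sin_max.
Qed.

(** Induction on [N], splitting off the first coordinate. The addition formulas mix the cosine and
    sine integrals of the tail, so both go through the induction together; every term with a
    vanishing sine integral drops out and the cosine integrals multiply. *)
Lemma abel_fourier N e (c : 'I_N -> R) : 0 < e ->
  \int[mu N]_xi (abel e xi * cos (lform c xi)) = \prod_(i < N) poisson1 e (c i) /\
  \int[mu N]_xi (abel e xi * sin (lform c xi)) = 0.
Proof.
move=> e0; elim: N c => [|N IH] c.
  rewrite big_ord0 /Rintegral !integral_dirac//.
  - by rewrite !diracT !mul1e /abel /lform !big_ord0 cos0 sin0 mulr0 mulr1.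
  - exact: measurable_int (integrable_abel_sin c e0).
  - exact: measurable_int (integrable_abel_cos c e0).
pose c' i := c (lift ord0 i); have [IHc IHs] := IH c'.
have ic1 := integrable_abel1_cos (c ord0) e0.
have is1 := integrable_abel1_sin (c ord0) e0.
have icN := integrable_abel_cos c' e0.
have isN := integrable_abel_sin c' e0.
split.
  transitivity (\int[mu N.+1]_xi
     ((abel1 e (thead xi) * cos (c ord0 * thead xi)) *
      (abel e (tbehead xi) * cos (lform c' (tbehead xi))) -
      (abel1 e (thead xi) * sin (c ord0 * thead xi)) *
      (abel e (tbehead xi) * sin (lform c' (tbehead xi))))).
    apply: eq_Rintegral => xi _; rewrite abelS lformS cosD.
    by rewrite -/c'; ring.
  rewrite RintegralB//; [|exact: (integrable_tensor_Rn ic1 icN)|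
    exact: (integrable_tensor_Rn is1 isN)].
  rewrite (Rintegral_tensor_Rn ic1 icN) (Rintegral_tensor_Rn is1 isN).
  by rewrite abel1_cos// IHc IHs mulr0 subr0 big_ord_recl.
transitivity (\int[mu N.+1]_xi
   ((abel1 e (thead xi) * sin (c ord0 * thead xi)) *
    (abel e (tbehead xi) * cos (lform c' (tbehead xi))) +
    (abel1 e (thead xi) * cos (c ord0 * thead xi)) *
    (abel e (tbehead xi) * sin (lform c' (tbehead xi))))).
  apply: eq_Rintegral => xi _; rewrite abelS lformS sinD.
  by rewrite -/c'; ring.
rewrite RintegralD//; [|exact: (integrable_tensor_Rn is1 icN)|
  exact: (integrable_tensor_Rn ic1 isN)].
rewrite (Rintegral_tensor_Rn is1 icN) (Rintegral_tensor_Rn ic1 isN).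
by rewrite abel1_sin// IHs mulr0 mul0r addr0.
Qed.

Definition poisson N (e : R) (x y : 'R^(R, N)) : R :=
  \prod_(i < N) poisson1 e (tnth x i - tnth y i).

Lemma poisson_ge0 N e (x y : 'R^(R, N)) : 0 < e -> 0 <= poisson e x y.
Proof. by move=> e0; apply: prodr_ge0 => i _; exact: poisson1_ge0. Qed.

Lemma poissonC N e (x y : 'R^(R, N)) : poisson e x y = poisson e y x.
Proof.
by apply: eq_bigr => i _; rewrite /poisson1 -opprB sqrrN.
Qed.

Lemma abel_cosB N e (x y : 'R^(R, N)) : 0 < e ->
  \int[mu N]_xi (abel e xi * cos (dotp x xi - dotp y xi)) = poisson e x y.
Proof.
move=> e0; rewrite /poisson.
have [<- _] := abel_fourier (fun i => tnth x i - tnth y i) e0.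
apply: eq_Rintegral => xi _; congr (_ * cos _).
by rewrite /dotp /lform -sumrB; apply: eq_bigr => i _; rewrite mulrBl.
Qed.

Lemma measurable_poisson1 e : 0 < e -> measurable_fun setT (@poisson1 R e).
Proof.
move=> e0; apply: continuous_measurable_fun => x.
apply: cvgM; first exact: cvg_cst.
apply: cvgV; first by rewrite gt_eqF// ltr_pwDl ?sqr_ge0// exprn_gt0.
by apply: cvgD; [exact: cvg_cst|exact: exprn_continuous].
Qed.

Lemma measurable_poisson N e : 0 < e ->
  measurable_fun setT (fun p : 'R^(R, N) * 'R^(R, N) => poisson e p.1 p.2).
Proof.
move=> e0; apply: measurable_prod => i _.
apply: measurableT_comp (measurable_poisson1 e0) _.
by apply: measurable_funB; apply: measurableT_comp (measurable_tnthR i) _.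
Qed.

Lemma integral_poisson N e (x : 'R^(R, N)) : 0 < e ->
  (\int[mu N]_y (poisson e x y)%:E = ((2 * pi) ^+ N)%:E)%E.
Proof.
move=> e0.
have mp M (z : 'R^(R, M)) : measurable_fun setT (fun y => (poisson e z y)%:E).
  apply/measurable_EFinP; apply: measurable_prod => i _.
  apply: measurableT_comp (measurable_poisson1 e0) _.
  by apply: measurable_funB => //; exact: measurable_tnthR.
elim: N x => [|N IH] x.
  rewrite [LHS]integral_dirac//; first by rewrite diracT mul1e /poisson big_ord0 expr0.
  exact: mp.
rewrite ge0_integral_RnS//; last by move=> y; rewrite lee_fin poisson_ge0.
transitivity (\int[leb]_a ((poisson1 e (thead x - a))%:E * ((2 * pi) ^+ N)%:E))%E.
  apply: eq_integral => a _; rewrite -(IH (tbehead x)) -ge0_integralZl//.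
  - apply: eq_integral => y _; rewrite -EFinM /poisson big_ord_recl.
    congr (_ * _)%:E; apply: eq_bigr => i _.
    by rewrite -!tnth_tbehead tbeheadE.
  - exact: mp.
  - by move=> y _; rewrite lee_fin poisson_ge0.
  - by rewrite lee_fin poisson1_ge0.
rewrite ge0_integralZr//.
- by rewrite integral_poisson1// -EFinM exprS.
- apply/measurable_EFinP; apply: measurableT_comp (measurable_poisson1 e0) _.
  exact: measurable_funB.
- by move=> y _; rewrite lee_fin poisson1_ge0.
- by rewrite lee_fin exprn_ge0// mulr_ge0// pi_ge0.
Qed.

End Rn.

(** * Parametric integrals and Fubini under a product majorant *)

Section parametric.
Context d1 d2 (T1 : measurableType d1) (T2 : measurableType d2) (R : realType).
Variables (m1 : {sigma_finite_measure set T1 -> \bar R})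
  (m2 : {sigma_finite_measure set T2 -> \bar R}).
Variable f : T1 * T2 -> R.
Hypothesis mf : measurable_fun setT f.

(** Tonelli makes the section integrals of the positive and negative parts measurable, and [fine] is
    measurable, so parameters with an infinite section integral do no harm. *)
Lemma measurable_fun_Rintegral : measurable_fun setT (fun x => \int[m2]_y f (x, y)).
Proof.
have mfE : measurable_fun setT (EFin \o f) by exact/measurable_EFinP.
rewrite /Rintegral.
apply: (@measurableT_comp _ _ _ _ _ _ fine) => //.
under eq_fun do rewrite integralE.
apply: emeasurable_funB.
- under eq_fun do under eq_integral do rewrite (funepos_comp (EFin \o f) (pair _)).
  apply: (measurable_fun_fubini_tonelli_F (EFin \o f)^\+%E) => //.
  exact: measurable_funepos.
- under eq_fun do under eq_integral do rewrite (funeneg_comp (EFin \o f) (pair _)).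
  apply: (measurable_fun_fubini_tonelli_F (EFin \o f)^\-%E) => //.
  exact: measurable_funeneg.
Qed.

Variables (u : T1 -> R) (v : T2 -> R).
Hypotheses (iu : m1.-integrable setT (EFin \o u))
  (iv : m2.-integrable setT (EFin \o v)).
Hypothesis fuv : forall x y, `|f (x, y)| <= u x * v y.

Lemma integrable_dominated_tensor : (m1 \x m2)%E.-integrable setT (EFin \o f).
Proof.
apply: le_integrable (integrable_tensor iu iv) => //; first exact/measurable_EFinP.
by move=> [x y] _; rewrite lee_fin (le_trans (fuv x y))// ler_norm.
Qed.

(** The bound [u x * v y] makes every section integrable, not just almost every one, so each inner
    real integral agrees with its extended-real counterpart and [Fubini] transfers. *)
Lemma Rfubini_dominated :
  \int[m1]_x \int[m2]_y f (x, y) = \int[m2]_y \int[m1]_x f (x, y).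
Proof.
have H := Fubini integrable_dominated_tensor.
rewrite {1}/Rintegral [in RHS]/Rintegral.
transitivity (fine (\int[m1]_x \int[m2]_y (f (x, y))%:E)%E).
  congr fine; apply: eq_integral => x _; rewrite /Rintegral fineK//.
  apply: integrable_fin_num => //.
  apply: le_integrable (integrableZl _ (u x) iv) => //.
    by apply/measurable_EFinP; exact: measurable_fun_pair2.
  by move=> y _ /=; rewrite lee_fin (le_trans (fuv x y))// ler_norm.
rewrite H; congr fine; apply: eq_integral => y _; rewrite /Rintegral fineK//.
apply: integrable_fin_num => //.
apply: le_integrable (integrableZl _ (v y) iu) => //.
  by apply/measurable_EFinP; exact: measurable_fun_pair1.
by move=> x _ /=; rewrite lee_fin (le_trans (fuv x y))// mulrC ler_norm.
Qed.

End parametric.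

(** If [g] fails to be integrable, the right-hand side is +oo. *)
Lemma le_EFin_normr_Rintegral d (T : measurableType d) (R : realType)
    (m : {measure set T -> \bar R}) (g : T -> R) : measurable_fun setT g ->
  ((`|\int[m]_x g x|)%:E <= \int[m]_x (`|g x|)%:E)%E.
Proof.
move=> mg; have mgE : measurable_fun setT (EFin \o g) by exact/measurable_EFinP.
have [gy|] := ltP (\int[m]_x (`|g x|)%:E)%E +oo%E; last first.
  by rewrite leye_eq => /eqP ->; exact: leey.
have ig : m.-integrable setT (EFin \o g) by apply/integrableP; split.
by rewrite EFin_normr_Rintegral// le_abse_integral.
Qed.

(** * Schur's test for a symmetric nonnegative kernel *)

Section schur.
Context d (T : measurableType d) (R : realType).
Variable m : {sigma_finite_measure set T -> \bar R}.
Variables (h : T -> R) (P : T * T -> R) (c : R).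
Hypotheses (mh : measurable_fun setT h) (mP : measurable_fun setT P).
Hypothesis P0 : forall p, 0 <= P p.
Hypothesis PC : forall x y, P (x, y) = P (y, x).
Hypothesis IP : forall x, (\int[m]_y (P (x, y))%:E = c%:E)%E.

(** The sign of [c] can be read off from [IP] only at a point of [T]; [IA] treats an empty [T]
    separately. *)
Let c0 : T -> (0 <= c%:E)%E.
Proof. by move=> t; rewrite -(IP t); apply: integral_ge0 => y _; rewrite lee_fin. Qed.

Let A (p : T * T) : \bar R := (h p.1 ^+ 2 * P p)%:E.

Let A0 p : (0 <= A p)%E.
Proof. by rewrite lee_fin mulr_ge0 ?sqr_ge0. Qed.

Let mA : measurable_fun setT A.
Proof.
apply/measurable_EFinP; apply: measurable_funM => //.
by apply: measurable_funX; exact: measurableT_comp.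
Qed.

Let B (p : T * T) : \bar R := (h p.2 ^+ 2 * P p)%:E.

Let B0 p : (0 <= B p)%E.
Proof. by rewrite lee_fin mulr_ge0 ?sqr_ge0. Qed.

Let mB : measurable_fun setT B.
Proof.
apply/measurable_EFinP; apply: measurable_funM => //.
by apply: measurable_funX; exact: measurableT_comp.
Qed.

Let IA : (\int[m]_x \int[m]_y A (x, y) = \int[m]_x (h x ^+ 2)%:E * c%:E)%E.
Proof.
transitivity (\int[m]_x ((h x ^+ 2)%:E * c%:E))%E.
  apply: eq_integral => x _; rewrite -(IP x) -ge0_integralZl//.
  - by apply/measurable_EFinP; exact: measurable_fun_pair2.
  - by move=> y _; rewrite lee_fin.
  - by rewrite lee_fin sqr_ge0.
have [/eqP T0|/set0P[t _]] := boolP ([set: T] == set0).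
  by rewrite T0 !integral_set0 mul0e.
rewrite ge0_integralZr//; last exact: c0 t.
- by apply/measurable_EFinP; exact: measurable_funX.
- by move=> x _; rewrite lee_fin sqr_ge0.
Qed.

Let IB : (\int[m]_x \int[m]_y B (x, y) = \int[m]_x (h x ^+ 2)%:E * c%:E)%E.
Proof.
rewrite (@fubini_tonelli _ _ _ _ _ m m B mB B0) -IA.
apply: eq_integral => y _; apply: eq_integral => x _.
by rewrite /A /B /= PC.
Qed.

(** By |h(x)| |h(y)| <= (h(x)^2 + h(y)^2) / 2 the form splits into two halves. One is computed by
    integrating first in y, and the other equals it by Tonelli and the symmetry of [P]. *)
Lemma schur_test : (\int[m]_x \int[m]_y (`|h x| * `|h y| * P (x, y))%:E <=
  \int[m]_x (h x ^+ 2)%:E * c%:E)%E.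
Proof.
pose K (p : T * T) : \bar R := (`|h p.1| * `|h p.2| * P p)%:E.
have K0 p : (0 <= K p)%E by rewrite lee_fin !mulr_ge0.
have mK : measurable_fun setT K.
  apply/measurable_EFinP; apply: measurable_funM => //.
  by apply: measurable_funM; do 2 apply: measurableT_comp => //.
rewrite -[leLHS]/(\int[m]_x \int[m]_y K (x, y))%E -(fubini_tonelli1 K)//.
apply: (@le_trans _ _ (\int[m \x m]_p ((2^-1)%:E * (A p + B p)))%E).
  apply: ge0_le_integral => //.
  - by apply: measurable_funeM; exact: emeasurable_funD.
  - move=> p _; rewrite lee_fin -mulrDl mulrA ler_wpM2r//.
    rewrite -(real_normK (num_real (h p.1))) -(real_normK (num_real (h p.2))).
    by have := sqr_ge0 (`|h p.1| - `|h p.2|); nra.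
rewrite ge0_integralZl//; last 2 first.
  exact: emeasurable_funD.
  by move=> p _; rewrite adde_ge0.
rewrite ge0_integralD// !fubini_tonelli1// IA IB.
rewrite -mule2n -(mule_natl _ 2) muleA -EFinM mulVf// mul1e.
exact: lexx.
Qed.

End schur.

(** * Plancherel's inequality with the Abel weight *)

Section plancherel.
Context {R : realType} {N : nat}.
Local Notation mu := (lebesgue_Rn R N).
Local Notation X := 'R^(R, N).
Implicit Types (h : X -> R) (x y xi : X).

Lemma measurable_dotp d (T : measurableType d) (f g : T -> X) :
  measurable_fun setT f -> measurable_fun setT g ->
  measurable_fun setT (fun t => dotp (f t) (g t)).
Proof.
move=> mf mg; apply: measurable_sum => i; apply: measurable_funM;
  exact: measurableT_comp (measurable_tnthR i) _.
Qed.

Lemma dotpC x y : dotp x y = dotp y x.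
Proof. by apply: eq_bigr => i _; rewrite mulrC. Qed.

(** For real [h], [cosT h] minus i times [sinT h] is the unnormalized Fourier transform hhat, so the
    sum of their squares is |hhat|^2. *)
Definition cosT h xi : R := \int[mu]_x (cos (dotp x xi) * h x).
Definition sinT h xi : R := \int[mu]_x (sin (dotp x xi) * h x).

Variable h : X -> R.
Hypothesis ih : mu.-integrable setT (EFin \o h).

Let mh : measurable_fun setT h.
Proof. by apply/measurable_EFinP; exact: measurable_int ih. Qed.

Let ihn : mu.-integrable setT (EFin \o (fun x => `|h x|)).
Proof. exact: integrable_norm. Qed.

Lemma measurable_cosT : measurable_fun setT (cosT h).
Proof.
apply: (@measurable_fun_Rintegral _ _ _ _ _ mu (fun p => cos (dotp p.2 p.1) * h p.2)).
apply: measurable_funM; last exact: measurableT_comp.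
apply: measurableT_comp; first exact: measurable_cosR.
exact: measurable_dotp.
Qed.

Lemma measurable_sinT : measurable_fun setT (sinT h).
Proof.
apply: (@measurable_fun_Rintegral _ _ _ _ _ mu (fun p => sin (dotp p.2 p.1) * h p.2)).
apply: measurable_funM; last exact: measurableT_comp.
apply: measurableT_comp; first exact: measurable_sinR.
exact: measurable_dotp.
Qed.

Lemma integrable_bounded_mul (g : X -> R) : measurable_fun setT g ->
  (forall x, `|g x| <= 1) -> mu.-integrable setT (EFin \o (fun x => g x * h x)).
Proof.
move=> mg g1; apply: le_integrable (ih) => //.
  by apply/measurable_EFinP; exact: measurable_funM.
by move=> x _; rewrite lee_fin normrM ler_piMl.
Qed.

Let H := \int[mu]_x `|h x|.

Lemma Rintegral_bounded_mul (g : X -> R) : measurable_fun setT g ->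
  (forall x, `|g x| <= 1) -> `|\int[mu]_x (g x * h x)| <= H.
Proof.
move=> mg g1; apply: le_trans (le_normr_Rintegral _ _) _ => //.
  exact: integrable_bounded_mul.
apply: le_Rintegral => //; first exact/integrable_norm/integrable_bounded_mul.
by move=> x _; rewrite normrM ler_piMl.
Qed.

Let mdx xi : measurable_fun setT (fun x => dotp x xi).
Proof. exact: measurable_dotp. Qed.

Let mdxi x : measurable_fun setT (dotp x).
Proof. exact: measurable_dotp. Qed.

Let mcx xi : measurable_fun setT (fun x => cos (dotp x xi)).
Proof. exact: (measurableT_comp measurable_cosR). Qed.

Let msx xi : measurable_fun setT (fun x => sin (dotp x xi)).
Proof. exact: (measurableT_comp measurable_sinR). Qed.

(** Both sides are the real part of exp(i x.xi) hhat(xi). *)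
Let cosT_sinT xi x : cos (dotp x xi) * cosT h xi + sin (dotp x xi) * sinT h xi =
  \int[mu]_y (cos (dotp x xi - dotp y xi) * h y).
Proof.
have ic : mu.-integrable setT (EFin \o (fun y => cos (dotp y xi) * h y)).
  by apply: integrable_bounded_mul => // y; exact: cos_max.
have is_ : mu.-integrable setT (EFin \o (fun y => sin (dotp y xi) * h y)).
  by apply: integrable_bounded_mul => // y; exact: sin_max.
rewrite -!RintegralZl// -RintegralD//.
- by apply: eq_Rintegral => y _; rewrite cosB; ring.
- exact: (integrableZl measurableT (cos (dotp x xi)) ic).
- exact: (integrableZl measurableT (sin (dotp x xi)) is_).
Qed.

Let cosT_sinT_le xi x :
  `|cos (dotp x xi) * cosT h xi + sin (dotp x xi) * sinT h xi| <= H.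
Proof.
rewrite cosT_sinT; apply: Rintegral_bounded_mul; last by move=> ?; exact: cos_max.
by apply: (measurableT_comp measurable_cosR); exact: measurable_funB.
Qed.

Variable e : R.
Hypothesis e0 : 0 < e.

Let iW := @integrable_abel R N e e0.

(** Abel summation of the inversion integral: swapping the integrals in y and xi leaves the
    transform of the weight at x - y, which is the Poisson kernel. *)
Let inner x : \int[mu]_xi (abel e xi *
    (cos (dotp x xi) * cosT h xi + sin (dotp x xi) * sinT h xi)) =
  \int[mu]_y (h y * poisson e x y).
Proof.
transitivity (\int[mu]_xi \int[mu]_y
   (abel e xi * cos (dotp x xi - dotp y xi) * h y)).
  apply: eq_Rintegral => xi _; rewrite cosT_sinT -RintegralZl//.
    by apply: eq_Rintegral => y _; rewrite mulrA.
  apply: integrable_bounded_mul; last by move=> ?; exact: cos_max.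
  by apply: (measurableT_comp measurable_cosR); exact: measurable_funB.
rewrite (@Rfubini_dominated _ _ _ _ _ mu mu
  (fun p => abel e p.1 * cos (dotp x p.1 - dotp p.2 p.1) * h p.2) _
  (abel e) (fun y => `|h y|))//.
- apply: eq_Rintegral => y _ /=; rewrite -abel_cosB// -RintegralZl//.
    by apply: eq_Rintegral => xi _; ring.
  apply: integrable_abelM_bounded => //; last by move=> ?; exact: cos_max.
  by apply: (measurableT_comp measurable_cosR); exact: measurable_funB.
- apply: measurable_funM; last exact: measurableT_comp.
  apply: measurable_funM; first exact: (measurableT_comp (measurable_abel e)).
  apply: (measurableT_comp measurable_cosR); apply: measurable_funB.
    exact: measurable_dotp.
  exact: measurable_dotp.
- move=> xi y /=; rewrite !normrM ler_wpM2r// ger0_norm ?abel_ge0//.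
  by rewrite ler_piMr ?abel_ge0// cos_max.
Qed.

(** |hhat|^2 is hhat times its conjugate. Only one of the two factors is expanded as an integral
    over x; after the swap, the integral in xi is the one computed in [inner]. The product majorant
    for the swap comes from |hhat| being bounded by the L^1 norm [H]. *)
Lemma plancherel_regularized :
  \int[mu]_xi (abel e xi * (cosT h xi ^+ 2 + sinT h xi ^+ 2)) =
  \int[mu]_x (h x * \int[mu]_y (h y * poisson e x y)).
Proof.
transitivity (\int[mu]_xi \int[mu]_x (abel e xi *
    (cos (dotp x xi) * cosT h xi + sin (dotp x xi) * sinT h xi) * h x)).
  apply: eq_Rintegral => xi _.
  have ic : mu.-integrable setT (EFin \o (fun y => cos (dotp y xi) * h y)).
    by apply: integrable_bounded_mul => // y; exact: cos_max.
  have is_ : mu.-integrable setT (EFin \o (fun y => sin (dotp y xi) * h y)).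
    by apply: integrable_bounded_mul => // y; exact: sin_max.
  have i1 := integrableZl measurableT (cosT h xi) ic.
  have i2 := integrableZl measurableT (sinT h xi) is_.
  rewrite !expr2 {2}/cosT {2}/sinT -!RintegralZl// -RintegralD// -RintegralZl//.
    by apply: eq_Rintegral => x _; ring.
  by apply: eq_integrable (integrableD measurableT i1 i2).
rewrite (@Rfubini_dominated _ _ _ _ _ mu mu
  (fun p => abel e p.1 * (cos (dotp p.2 p.1) * cosT h p.1 +
                          sin (dotp p.2 p.1) * sinT h p.1) * h p.2) _
  (fun xi => abel e xi * H) (fun y => `|h y|))//.
- apply: eq_Rintegral => x _ /=; rewrite -inner mulrC -RintegralZr//.
  apply: le_integrable (integrableZr _ H iW) => //.
    apply/measurable_EFinP; apply: measurable_funM; first exact: measurable_abel.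
    apply: measurable_funD; apply: measurable_funM.
    + exact: (measurableT_comp measurable_cosR).
    + exact: measurable_cosT.
    + exact: (measurableT_comp measurable_sinR).
    + exact: measurable_sinT.
  move=> xi _ /=; rewrite lee_fin !normrM ler_wpM2l//.
  by rewrite (le_trans (cosT_sinT_le _ _))// ler_norm.
- apply: measurable_funM; last exact: measurableT_comp.
  apply: measurable_funM; first exact: (measurableT_comp (measurable_abel e)).
  apply: measurable_funD; apply: measurable_funM.
  + by apply: (measurableT_comp measurable_cosR); exact: measurable_dotp.
  + exact: (measurableT_comp measurable_cosT).
  + by apply: (measurableT_comp measurable_sinR); exact: measurable_dotp.
  + exact: (measurableT_comp measurable_sinT).
- by apply: eq_integrable (integrableZr measurableT H iW).
- move=> xi x /=; rewrite !normrM ler_wpM2r// ger0_norm ?abel_ge0//.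
  by rewrite ler_wpM2l ?abel_ge0// cosT_sinT_le.
Qed.

Lemma integrable_plancherel_regularized :
  mu.-integrable setT (fun xi => (abel e xi * (cosT h xi ^+ 2 + sinT h xi ^+ 2))%:E).
Proof.
apply: le_integrable (integrableZr _ (H ^+ 2 + H ^+ 2) iW) => //.
  apply/measurable_EFinP; apply: measurable_funM; first exact: measurable_abel.
  apply: measurable_funD; apply: measurable_funX; [exact: measurable_cosT|].
  exact: measurable_sinT.
move=> xi _ /=; rewrite lee_fin !normrM ler_wpM2l//.
have sqrH t : `|t| <= H -> t ^+ 2 <= H ^+ 2.
  by move=> tH; rewrite -(real_normK (num_real t)) lerXn2r ?nnegrE ?(le_trans _ tH).
rewrite !ger0_norm ?addr_ge0 ?sqr_ge0// lerD// sqrH//.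
  by apply: Rintegral_bounded_mul => // x; exact: cos_max.
by apply: Rintegral_bounded_mul => // x; exact: sin_max.
Qed.

(** [h] is only assumed integrable, so the right-hand side may be infinite and the bound is stated
    in [\bar R]. The left-hand side is finite thanks to the weight, so it can be rewritten as a real
    integral, and taking absolute values inside leads to Schur's test with row integrals (2
    pi)^N. *)
Lemma plancherel_regularized_le :
  (\int[mu]_xi (abel e xi * (cosT h xi ^+ 2 + sinT h xi ^+ 2))%:E <=
   \int[mu]_x (h x ^+ 2)%:E * ((2 * pi) ^+ N)%:E)%E.
Proof.
pose K (p : X * X) : R := h p.2 * poisson e p.1 p.2.
have mK : measurable_fun setT K.
  by apply: measurable_funM; [exact: measurableT_comp|exact: measurable_poisson].
have mJ : measurable_fun setT (fun x => \int[mu]_y K (x, y)).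
  exact: measurable_fun_Rintegral.
have S := (@schur_test _ _ _ mu h (fun p => poisson e p.1 p.2) _ mh
  (measurable_poisson e0) (fun p => poisson_ge0 p.1 p.2 e0)
  (fun x y => poissonC e x y) (fun x => integral_poisson x e0)).
apply: le_trans S.
rewrite -[leLHS]fineK; last exact: integrable_fin_num integrable_plancherel_regularized.
rewrite -/(Rintegral _ _ _) plancherel_regularized.
apply: le_trans (_ : ((`|\int[mu]_x (h x * \int[mu]_y K (x, y))|)%:E <= _)%E).
  by rewrite lee_fin ler_norm.
apply: le_trans (le_EFin_normr_Rintegral _ _) _; first exact: measurable_funM.
apply: ge0_le_integral => //.
- by apply/measurable_EFinP; apply: measurableT_comp => //; exact: measurable_funM.
- apply: (measurable_fun_fubini_tonelli_F
    (fun p : X * X => (`|h p.1| * `|h p.2| * poisson e p.1 p.2)%:E)).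
    apply/measurable_EFinP; apply: measurable_funM; last exact: measurable_poisson.
    by apply: measurable_funM; do 2 apply: measurableT_comp => //.
  by move=> p; rewrite lee_fin !mulr_ge0// poisson_ge0.
- move=> x _; rewrite normrM EFinM.
  apply: (@le_trans _ _ (`|h x|%:E * \int[mu]_y (`|K (x, y)|)%:E)%E).
    apply: lee_wpmul2l => //; apply: le_EFin_normr_Rintegral.
    exact: measurable_fun_pair2.
  rewrite -ge0_integralZl//; last first.
    apply/measurable_EFinP; apply: measurableT_comp => //.
    exact: measurable_fun_pair2.
  rewrite le_eqVlt; apply/orP; left; apply/eqP; apply: eq_integral => y _.
  rewrite /K -EFinM normrM (ger0_norm (poisson_ge0 x y e0)).
  by rewrite mulrA.
Qed.

End plancherel.

(** * Removal of the Abel weight *)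

Lemma cvg_abel (R : realType) N (xi : 'R^(R, N)) :
  abel (n.+1%:R^-1) xi @[n --> \oo] --> (1 : R).
Proof.
rewrite (_ : (fun n => _) =
    (fun n => expR (- (n.+1%:R^-1 * \sum_(i < N) `|tnth xi i|)))); last first.
  by apply/funext => n; rewrite mulr_sumr -sumrN expR_sum.
rewrite -[X in _ --> X]expR0; apply: continuous_cvg; first exact: continuous_expR.
rewrite -[X in _ --> X]oppr0; apply: cvgN.
rewrite -[X in _ --> X](mul0r (\sum_(i < N) `|tnth xi i|)).
apply: cvgM; last exact: cvg_cst.
exact: cvg_harmonic.
Qed.

Lemma abel_nonincreasing (R : realType) N (xi : 'R^(R, N)) (e e' : R) :
  e <= e' -> abel e' xi <= abel e xi.
Proof.
move=> ee'; apply: ler_prod => i _; rewrite abel1_ge0/= ler_expR lerN2.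
by rewrite ler_wpM2r.
Qed.

Section plancherel_le.
Context {R : realType} {N : nat}.
Local Notation mu := (lebesgue_Rn R N).
Local Notation X := 'R^(R, N).

(** The regularized bound does not depend on e. Along e = 1 / (n + 1) the weights increase to 1, and
    monotone convergence passes to the limit. *)
Lemma plancherel_le (h : X -> R) : mu.-integrable setT (EFin \o h) ->
  (\int[mu]_xi (cosT h xi ^+ 2 + sinT h xi ^+ 2)%:E <=
   \int[mu]_x (h x ^+ 2)%:E * ((2 * pi) ^+ N)%:E)%E.
Proof.
move=> ih.
pose E xi := cosT h xi ^+ 2 + sinT h xi ^+ 2.
have E0 xi : 0 <= E xi by rewrite addr_ge0 ?sqr_ge0.
have mE : measurable_fun setT E.
  apply: measurable_funD; apply: measurable_funX; [exact: measurable_cosT|].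
  exact: measurable_sinT.
pose g n xi := (abel (n.+1%:R^-1) xi * E xi)%:E.
have mg n : measurable_fun setT (g n).
  apply/measurable_EFinP; apply: measurable_funM => //; exact: measurable_abel.
have g0 n xi : setT xi -> (0 <= g n xi)%E.
  by move=> _; rewrite lee_fin mulr_ge0// abel_ge0.
have ndg xi : setT xi -> {homo g^~ xi : n m / (n <= m)%N >-> (n <= m)%E}.
  move=> _ n m nm; rewrite lee_fin ler_wpM2r// abel_nonincreasing//.
  by rewrite lef_pV2 ?posrE// ler_nat.
have -> : (\int[mu]_xi (E xi)%:E = \int[mu]_xi limn (g^~ xi))%E.
  apply: eq_integral => xi _; apply/esym/cvg_lim => //.
  apply: cvg_EFin; first exact: nearW.
  rewrite -[X in _ --> X]mul1r; apply: cvgM; last exact: cvg_cst.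
  exact: cvg_abel.
rewrite monotone_convergence//; apply: lime_le.
  apply: ereal_nondecreasing_is_cvgn => n m nm.
  apply: ge0_le_integral => //.
    by move=> xi _; exact: g0.
  by move=> xi _; exact: (ndg xi).
by apply: nearW => n; apply: plancherel_regularized_le; rewrite // invr_gt0.
Qed.

End plancherel_le.

(** * A one-dimensional Sobolev inequality in time *)

(** The derivative 2 u v of u^2 is at most k u^2 + v^2 / k in absolute value. Integrating this
    nonnegative bound over all of [[al, be]], rather than between [t0] and [t], makes the right-hand
    side independent of [t]; [k] is left free to balance the two terms. *)
Lemma continuous_sqr_le_integral (R : realType) (u v : R -> R) (k al be t0 t : R) :
  0 < k -> (forall s : R, is_derive s (1 : R) u (v s)) -> continuous v ->
  t0 \in `[al, be] -> t \in `[al, be] ->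
  ((u t ^+ 2)%:E <= (u t0 ^+ 2)%:E +
    \int[lebesgue_measure]_(s in `[al, be]) (k * u s ^+ 2 + k^-1 * v s ^+ 2)%:E)%E.
Proof.
move=> k0 du cv.
have cu : continuous u.
  by move=> s; apply/differentiable_continuous/derivable1_diffP; have [] := du s.
pose w s := k * u s ^+ 2 + k^-1 * v s ^+ 2.
have w0 s : 0 <= w s by rewrite addr_ge0// mulr_ge0 ?sqr_ge0// ?invr_ge0 ltW.
have cw : continuous w.
  move=> s; apply: cvgD; apply: cvgM; try exact: cvg_cst.
    by rewrite expr2; apply: cvgM; exact: cu.
  by rewrite expr2; apply: cvgM; exact: cv.
pose z s := 2 * u s * v s.
have cz : continuous z.
  by move=> s; apply: cvgM; last exact: cv; apply: cvgM; [exact: cvg_cst|exact: cu].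
have zw s : `|z s| <= w s.
  (* Completing the square; c = 1 and c = -1 give the two sides of the absolute value. *)
  have wE c : c ^+ 2 = 1 -> w s - c * z s = k^-1 * (k * u s - c * v s) ^+ 2.
    move=> c1; rewrite /w /z; apply/eqP; rewrite -subr_eq0; apply/eqP.
    transitivity (k^-1 * v s ^+ 2 * (1 - c ^+ 2)); last by rewrite c1 subrr mulr0.
    by field; rewrite gt_eqF.
  have sq0 r : 0 <= k^-1 * r ^+ 2 by rewrite mulr_ge0 ?sqr_ge0// invr_ge0 ltW.
  rewrite ler_norml; apply/andP; split.
    by have := sq0 (k * u s - (- 1) * v s); rewrite -wE ?sqrrN ?expr1n//; lra.
  by have := sq0 (k * u s - 1 * v s); rewrite -wE ?expr1n//; lra.
have dsq (s : R) : is_derive s (1 : R) (fun s => u s ^+ 2) (z s).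
  by apply: is_derive_eq; rewrite /z /GRing.scale/= /GRing.scale/=; ring.
have csq : continuous (fun s => u s ^+ 2).
  under eq_fun do rewrite expr2.
  by move=> s; apply: cvgM; exact: cu.
have intc (f : R -> R) (a b : R) : continuous f ->
    lebesgue_measure.-integrable `[a, b] (EFin \o f).
  move=> cf; apply: continuous_compact_integrable; first exact: segment_compact.
  exact: continuous_subspaceT.
have main a b : a < b -> al <= a -> b <= be ->
   (`|u b ^+ 2 - u a ^+ 2|%:E <= \int[lebesgue_measure]_(s in `[al, be]) (w s)%:E)%E.
  move=> ab ala bbe.
  have FTC := @continuous_FTC2 _ z (fun s => u s ^+ 2) a b ab.
  rewrite -abse_EFin EFinB -FTC; last 3 first.
  - exact: continuous_subspaceT.
  - split.
    + by move=> s _; have [] := dsq s.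
    + apply: cvg_at_right_filter; exact: csq.
    + apply: cvg_at_left_filter; exact: csq.
  - by move=> s _; rewrite derive1E; have [_ ->] := dsq s.
  have sub : `[a, b] `<=` `[al, be] by apply: subset_itv; rewrite bnd_simp.
  have mw : measurable_fun setT (fun s => (w s)%:E).
    by apply/measurable_EFinP; exact: continuous_measurable_fun.
  have mz : measurable_fun setT (fun s => (z s)%:E).
    by apply/measurable_EFinP; exact: continuous_measurable_fun.
  apply: le_trans (le_abse_integral _ _ _) _; [by []|exact: measurable_funTS|].
  apply: (@le_trans _ _ (\int[lebesgue_measure]_(s in `[a, b]) (w s)%:E)%E).
    apply: ge0_le_integral => //.
    - by apply: measurableT_comp => //; exact: measurable_funTS.
    - exact: measurable_funTS.
    - by move=> s _; rewrite lee_fin.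
  apply: ge0_subset_integral => //; first exact: measurable_funTS.
  by move=> s _; rewrite lee_fin.
rewrite !in_itv/= => /andP[alt0 t0be] /andP[alt tbe].
rewrite -leeBlDl//.
have [t0t|tt0|->] := ltgtP t0 t.
- apply: le_trans (main _ _ t0t alt0 tbe); by rewrite lee_fin ler_norm.
- apply: le_trans (main _ _ tt0 alt t0be); by rewrite lee_fin distrC ler_norm.
- by rewrite subee//; apply: integral_ge0 => s _; rewrite lee_fin; exact: w0.
Qed.

(** * Energy and maximal estimates for a general real phase *)

Section propagator.
Context {R : realType} {N : nat}.
Local Notation mu := (lebesgue_Rn R N).
Local Notation X := 'R^(R, N).
Variables (phi : X -> R) (L : R).
Hypothesis mphi : measurable_fun setT phi.
Implicit Types (a b : X -> R) (t : R) (x xi : X).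

(* The real part of the integral of exp (i (x.xi + t phi)) (a + i b); its
   imaginary part is propag b (- a), so only this real integral is studied. *)
Definition propag a b t x : R := \int[mu]_xi
  (cos (dotp x xi + t * phi xi) * a xi - sin (dotp x xi + t * phi xi) * b xi).

(** The second clause says that |phi| <= L wherever [a] is nonzero. In this form it is preserved by
    multiplication by [phi], which is what a time derivative does to the data. *)
Definition band_limited a := [/\ mu.-integrable setT (EFin \o a) &
  forall xi, `|phi xi * a xi| <= L * `|a xi|].

Lemma band_limitedN a : band_limited a -> band_limited (fun xi => - a xi).
Proof.
move=> [ia La]; split; last by move=> xi; rewrite mulrN !normrN.
by apply: eq_integrable (integrableN ia).
Qed.

Lemma band_limitedM a : band_limited a -> band_limited (fun xi => phi xi * a xi).
Proof.
move=> [ia La]; split; last first.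
  by move=> xi; rewrite normrM [in leRHS]normrM [leRHS]mulrCA ler_wpM2l.
apply: le_integrable (integrableZl measurableT L ia) => //.
  apply/measurable_EFinP; apply: measurable_funM => //.
  by apply/measurable_EFinP; exact: measurable_int ia.
move=> xi _ /=; rewrite lee_fin (le_trans (La xi))// normrM ler_wpM2r//.
exact: ler_norm.
Qed.

Lemma measurable_propag a b : measurable_fun setT a -> measurable_fun setT b ->
  measurable_fun setT (fun p : measurableTypeR R * X => propag a b p.1 p.2).
Proof.
move=> ma mb.
apply: (@measurable_fun_Rintegral _ _ _ _ _ mu
  (fun q : (measurableTypeR R * X) * X =>
     cos (dotp q.1.2 q.2 + q.1.1 * phi q.2) * a q.2 -
     sin (dotp q.1.2 q.2 + q.1.1 * phi q.2) * b q.2)).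
have mp : measurable_fun setT
    (fun q : (measurableTypeR R * X) * X => dotp q.1.2 q.2 + q.1.1 * phi q.2).
  apply: measurable_funD.
    by apply: measurable_dotp => //; exact: measurableT_comp.
  by apply: measurable_funM; exact: measurableT_comp.
apply: measurable_funB; apply: measurable_funM.
- exact: (measurableT_comp measurable_cosR).
- exact: measurableT_comp.
- exact: (measurableT_comp measurable_sinR).
- exact: measurableT_comp.
Qed.

(** The derivative in t multiplies a + i b by i phi, that is, sends the pair (a, b) to (- phi b, phi
    a). The sum [G] of the absolute values of these two functions dominates the derivative at all
    times. *)
Lemma propag_derive a b t x : band_limited a -> band_limited b ->
  is_derive t (1 : R) (propag a b ^~ x)
    (propag (fun xi => - (phi xi * b xi)) (fun xi => phi xi * a xi) t x).
Proof.
move=> [ia La] [ib Lb].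
have [ipa _] := band_limitedM (conj ia La).
have [ipb _] := band_limitedM (conj ib Lb).
pose f (s : R) xi := cos (dotp x xi + s * phi xi) * a xi -
                     sin (dotp x xi + s * phi xi) * b xi.
have df (s : R) xi : is_derive s (1 : R) (f ^~ xi)
    (cos (dotp x xi + s * phi xi) * - (phi xi * b xi) -
     sin (dotp x xi + s * phi xi) * (phi xi * a xi)).
  by rewrite /f; apply: is_derive_eq; rewrite /GRing.scale/=; ring.
have d1E (s : R) xi : partial1of2 f s xi =
    cos (dotp x xi + s * phi xi) * - (phi xi * b xi) -
    sin (dotp x xi + s * phi xi) * (phi xi * a xi).
  by rewrite partial1of2E; have [_ ->] := df s xi.
have It : `](t - 1), (t + 1)[%classic t.
  by rewrite /= in_itv/=; apply/andP; split; lra.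
pose G xi := `|phi xi * b xi| + `|phi xi * a xi|.
have G0 xi : 0 <= G xi by rewrite addr_ge0.
have iG : mu.-integrable setT (EFin \o G).
  by apply: eq_integrable
    (integrableD measurableT (integrable_norm ipb) (integrable_norm ipa)).
have mp (s : R) : measurable_fun setT (fun xi => dotp x xi + s * phi xi).
  apply: measurable_funD; first exact: measurable_dotp.
  exact: measurable_funM.
have iF (s : R) : mu.-integrable setT (EFin \o f s).
  apply: eq_integrable (integrableB measurableT
    (integrable_bounded_mul ia (measurableT_comp measurable_cosR (mp s)) _)
    (integrable_bounded_mul ib (measurableT_comp measurable_sinR (mp s)) _)) => //.
  - by move=> ?; exact: cos_max.
  - by move=> ?; exact: sin_max.
have GP (s : R) xi : `|partial1of2 f s xi| <= G xi.
  rewrite d1E (le_trans (ler_normB _ _))// lerD// normrM ?normrN ler_piMl//.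
    by exact: cos_max.
  by exact: sin_max.
have iF' (s : R) : `](t - 1), (t + 1)[%classic s ->
  mu.-integrable setT (EFin \o f s) by [].
have df' (s : R) xi : `](t - 1), (t + 1)[%classic s -> setT xi ->
    derivable (f ^~ xi) s 1.
  by move=> _ _; have [] := df s xi.
have GP' (s : R) xi : `](t - 1), (t + 1)[%classic s -> setT xi ->
  `|partial1of2 f s xi| <= G xi by [].
apply: DeriveDef.
  exact: (derivable_under_integral measurableT It iF' df' G0 iG GP').
rewrite -derive1E (differentiation_under_integral measurableT It iF' df' G0 iG GP').
by apply: eq_Rintegral => xi _; rewrite d1E.
Qed.

(** The real part of exp(i t phi) (a + i b); its imaginary part is [psi] at b and - a. *)
Let psi a b t xi := cos (t * phi xi) * a xi - sin (t * phi xi) * b xi.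

Let integrable_psi a b t : mu.-integrable setT (EFin \o a) ->
  mu.-integrable setT (EFin \o b) -> mu.-integrable setT (EFin \o psi a b t).
Proof.
move=> ia ib; have mt : measurable_fun setT (fun xi => t * phi xi).
  exact: measurable_funM.
apply: eq_integrable (integrableB measurableT
  (integrable_bounded_mul ia (measurableT_comp measurable_cosR mt) _)
  (integrable_bounded_mul ib (measurableT_comp measurable_sinR mt) _)) => //.
- by move=> ?; exact: cos_max.
- by move=> ?; exact: sin_max.
Qed.

Let propagE a b t x : mu.-integrable setT (EFin \o a) ->
  mu.-integrable setT (EFin \o b) ->
  propag a b t x = cosT (psi a b t) x - sinT (psi b (fun xi => - a xi) t) x.
Proof.
move=> ia ib.
have iNa : mu.-integrable setT (EFin \o (fun xi => - a xi)).
  by apply: eq_integrable (integrableN ia).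
have mdx : measurable_fun setT (fun xi : X => dotp xi x) by exact: measurable_dotp.
rewrite /cosT /sinT -RintegralB//.
- by apply: eq_Rintegral => xi _; rewrite dotpC cosD sinD /psi; ring.
- apply: (integrable_bounded_mul (integrable_psi t ia ib)).
    exact: (measurableT_comp measurable_cosR).
  by move=> ?; exact: cos_max.
- apply: (integrable_bounded_mul (integrable_psi t ib iNa)).
    exact: (measurableT_comp measurable_sinR).
  by move=> ?; exact: sin_max.
Qed.

(** exp(i t phi) has modulus 1, so the evolved data p + i q satisfies p^2 + q^2 = a^2 + b^2
    pointwise. The factor 2 comes from (u - v)^2 <= 2 u^2 + 2 v^2 applied to [cosT p - sinT q], and
    (2 pi)^N from [plancherel_le]. *)
Lemma integral_propag_sqr a b t : mu.-integrable setT (EFin \o a) ->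
  mu.-integrable setT (EFin \o b) ->
  (\int[mu]_x (propag a b t x ^+ 2)%:E <=
   (2 * (2 * pi) ^+ N)%:E * \int[mu]_x (a x ^+ 2 + b x ^+ 2)%:E)%E.
Proof.
move=> ia ib.
have iNa : mu.-integrable setT (EFin \o (fun xi => - a xi)).
  by apply: eq_integrable (integrableN ia).
have ip := integrable_psi t ia ib; have iq := integrable_psi t ib iNa.
set p := psi a b t; set q := psi b (fun xi => - a xi) t.
have mp : measurable_fun setT p by apply/measurable_EFinP; exact: measurable_int ip.
have mq : measurable_fun setT q by apply/measurable_EFinP; exact: measurable_int iq.
have pq xi : a xi ^+ 2 + b xi ^+ 2 = p xi ^+ 2 + q xi ^+ 2.
  rewrite /p /q /psi.
  transitivity ((cos (t * phi xi) ^+ 2 + sin (t * phi xi) ^+ 2) *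
                (a xi ^+ 2 + b xi ^+ 2)).
    by rewrite cos2Dsin2 mul1r.
  by ring.
have mE (h : X -> R) : mu.-integrable setT (EFin \o h) ->
    measurable_fun setT (fun x => (cosT h x ^+ 2 + sinT h x ^+ 2)%:E).
  move=> ih; apply/measurable_EFinP; apply: measurable_funD.
    by apply: measurable_funX; exact: measurable_cosT.
  by apply: measurable_funX; exact: measurable_sinT.
pose E h x : \bar R := (cosT h x ^+ 2 + sinT h x ^+ 2)%:E.
have E0 h x : (0 <= E h x)%E by rewrite lee_fin addr_ge0 ?sqr_ge0.
apply: (@le_trans _ _ (\int[mu]_x (2%:E * (E p x + E q x)))%E).
  apply: ge0_le_integral => //.
  - by move=> x _; rewrite lee_fin sqr_ge0.
  - apply/measurable_EFinP; apply: measurable_funX.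
    rewrite (_ : propag a b t = fun x => cosT p x - sinT q x); last first.
      by apply/funext => x; exact: propagE.
    by apply: measurable_funB; [exact: measurable_cosT|exact: measurable_sinT].
  - by apply: measurable_funeM; apply: emeasurable_funD; exact: mE.
  - move=> x _; rewrite propagE// -/p -/q /E -EFinD -EFinM lee_fin.
    have := sqr_ge0 (cosT p x + sinT q x).
    have := sqr_ge0 (sinT p x); have := sqr_ge0 (cosT q x).
    by nra.
rewrite ge0_integralZl//; last 2 first.
  by apply: emeasurable_funD; exact: mE.
  by move=> x _; rewrite adde_ge0.
rewrite ge0_integralD//; [|exact: mE|exact: mE].
under [in leRHS]eq_integral do rewrite pq EFinD.
rewrite [in leRHS]ge0_integralD//; last 4 first.
- by move=> x _; rewrite lee_fin sqr_ge0.
- by apply/measurable_EFinP; exact: measurable_funX.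
- by move=> x _; rewrite lee_fin sqr_ge0.
- by apply/measurable_EFinP; exact: measurable_funX.
rewrite EFinM -muleA lee_pmul2l// muleC ge0_muleDl; last 2 first.
- by apply: integral_ge0 => x _; rewrite lee_fin sqr_ge0.
- by apply: integral_ge0 => x _; rewrite lee_fin sqr_ge0.
by apply: leeD; exact: plancherel_le.
Qed.

Lemma continuous_propag a b x : band_limited a -> band_limited b ->
  continuous (propag a b ^~ x).
Proof.
move=> ba bb t; apply/differentiable_continuous/derivable1_diffP.
by have [] := propag_derive t x ba bb.
Qed.

Hypothesis L0 : 0 < L.

(** The supremum in t is represented by a majorant [H] that is an explicit time integral, hence
    measurable, and whose integral in x Tonelli reduces to the energy at each fixed time. *)
Lemma maximal_propag a b (k al be t0 : R) : band_limited a -> band_limited b ->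
  0 < k -> t0 \in `[al, be] ->
  exists H : X -> \bar R,
    [/\ measurable_fun setT H, forall x, (0 <= H x)%E,
      forall t x, t \in `[al, be] -> ((propag a b t x ^+ 2)%:E <= H x)%E &
      (\int[mu]_x H x <=
       ((1 + (be - al) * (k + k^-1 * L ^+ 2)) * (2 * (2 * pi) ^+ N))%:E *
       \int[mu]_x (a x ^+ 2 + b x ^+ 2)%:E)%E].
Proof.
move=> ba bb k0 t0I; have [ia La] := ba; have [ib Lb] := bb.
pose a' xi := - (phi xi * b xi); pose b' xi := phi xi * a xi.
have ba' : band_limited a' by apply: band_limitedN; exact: band_limitedM.
have bb' : band_limited b' by exact: band_limitedM.
have [ia' _] := ba'; have [ib' _] := bb'.
have meas c : band_limited c -> measurable_fun setT c.
  by move=> [ic _]; apply/measurable_EFinP; exact: measurable_int ic.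
have mP c d : band_limited c -> band_limited d ->
    measurable_fun setT (fun p : X * measurableTypeR R => propag c d p.2 p.1).
  move=> bc bd.
  apply: (measurableT_comp (measurable_propag (meas _ bc) (meas _ bd))
    (_ : measurable_fun setT (fun p : X * measurableTypeR R => (p.2, p.1)))).
  exact: measurable_fun_pair.
have mp2 c d s : band_limited c -> band_limited d ->
    measurable_fun setT (fun x => (propag c d s x ^+ 2)%:E).
  move=> bc bd; apply/measurable_EFinP; apply: measurable_funX.
  exact: (@measurable_fun_pair1 _ _ _ _ _ _
    (fun p : X * measurableTypeR R => propag c d p.2 p.1) s (mP c d bc bd)).
have p20 c d s x : (0 <= (propag c d s x ^+ 2)%:E)%E by rewrite lee_fin sqr_ge0.
have mab c d : band_limited c -> band_limited d ->
    measurable_fun setT (fun x => (c x ^+ 2 + d x ^+ 2)%:E).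
  move=> bc bd; apply/measurable_EFinP.
  by apply: measurable_funD; apply: measurable_funX; exact: meas.
have k10 : 0 <= k^-1 by rewrite invr_ge0 ltW.
have mkp (r : R) c d s : band_limited c -> band_limited d ->
    measurable_fun setT (fun x => (r%:E * (propag c d s x ^+ 2)%:E)%E).
  by move=> bc bd; apply: measurable_funeM; exact: mp2.
pose w s x := k * propag a b s x ^+ 2 + k^-1 * propag a' b' s x ^+ 2.
have w0 s x : 0 <= w s x by rewrite addr_ge0// mulr_ge0 ?sqr_ge0// ?invr_ge0 ltW.
(* The time interval enters as an indicator, so that Tonelli applies on the full product space. *)
pose W (p : X * measurableTypeR R) : \bar R :=
  (w p.2 p.1 * \1_(`[al, be]%classic) p.2)%:E.
have W0 p : (0 <= W p)%E by rewrite lee_fin mulr_ge0.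
have mW : measurable_fun setT W.
  apply/measurable_EFinP; apply: measurable_funM.
    apply: measurable_funD; apply: measurable_funM => //;
      by apply: measurable_funX; exact: mP.
  apply: measurableT_comp => //; exact: measurable_indic.
have WE x : (\int[lebesgue_measure]_(s in `[al, be]) (w s x)%:E =
    \int[lebesgue_measure]_s W (x, s))%E.
  rewrite integral_mkcond; apply: eq_integral => s _.
  by rewrite /W patchE/= indicE; case: ifPn => _; rewrite ?mulr1 ?mulr0.
pose M : R := 2 * (2 * pi) ^+ N.
have M0 : 0 <= M by rewrite mulr_ge0// exprn_ge0// mulr_ge0// pi_ge0.
set I2 := (\int[mu]_x (a x ^+ 2 + b x ^+ 2)%:E)%E.
have I20 : (0 <= I2)%E.
  by apply: integral_ge0 => x _; rewrite lee_fin addr_ge0 ?sqr_ge0.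
have I2' : (\int[mu]_x (a' x ^+ 2 + b' x ^+ 2)%:E <= (L ^+ 2)%:E * I2)%E.
  rewrite /I2 -ge0_integralZl//; last 3 first.
  - exact: mab.
  - by move=> x _; rewrite lee_fin addr_ge0 ?sqr_ge0.
  - by rewrite lee_fin sqr_ge0.
  apply: ge0_le_integral => //.
  - by move=> x _; rewrite lee_fin addr_ge0 ?sqr_ge0.
  - exact: mab.
  - by apply: measurable_funeM; exact: mab.
  - move=> x _; rewrite -EFinM lee_fin mulrDr addrC.
    have sqL c : `|phi x * c| <= L * `|c| -> (phi x * c) ^+ 2 <= L ^+ 2 * c ^+ 2.
      move=> cL; rewrite -exprMn -(real_normK (num_real (phi x * c))).
      rewrite -(real_normK (num_real (L * c))) [in leRHS]normrM (gtr0_norm L0).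
      by rewrite lerXn2r ?nnegrE// (le_trans _ cL).
    by rewrite /a' /b' sqrrN lerD// sqL.
(* The bound is uniform in the time s, so integrating it over the interval only costs the factor
   [be - al]. *)
have Iw s : (\int[mu]_x (w s x)%:E <= (k + k^-1 * L ^+ 2)%:E * (M%:E * I2))%E.
  under eq_integral do rewrite EFinD (EFinM k) (EFinM k^-1).
  rewrite ge0_integralD//; last 4 first.
  - by move=> x _; apply: mule_ge0; rewrite // lee_fin ltW.
  - exact: mkp.
  - by move=> x _; apply: mule_ge0.
  - exact: mkp.
  rewrite ge0_integralZl//; [|exact: mp2|by rewrite lee_fin ltW].
  rewrite ge0_integralZl//; last exact: mp2.
  rewrite EFinD ge0_muleDl; last 2 first.
  - by rewrite lee_fin ltW.
  - by rewrite lee_fin mulr_ge0 ?sqr_ge0.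
  apply: leeD.
    apply: lee_wpmul2l; first by rewrite lee_fin ltW.
    exact: integral_propag_sqr.
  rewrite EFinM -muleA; apply: lee_wpmul2l; first by rewrite lee_fin invr_ge0 ltW.
  apply: le_trans (integral_propag_sqr s ia' ib') _.
  rewrite muleCA; apply: lee_wpmul2l; first by rewrite lee_fin.
  exact: I2'.
exists (fun x => (propag a b t0 x ^+ 2)%:E + \int[lebesgue_measure]_s W (x, s))%E; split.
- apply: emeasurable_funD; first exact: mp2.
  exact: measurable_fun_fubini_tonelli_F.
- move=> x; rewrite adde_ge0 ?lee_fin ?sqr_ge0//; exact: integral_ge0.
- move=> t x tI; rewrite -WE; apply: continuous_sqr_le_integral => //.
    by move=> s; exact: propag_derive.
  exact: continuous_propag.
- rewrite ge0_integralD//; last 3 first.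
  + exact: mp2.
  + by move=> x _; exact: integral_ge0.
  + exact: measurable_fun_fubini_tonelli_F.
  rewrite (@fubini_tonelli _ _ _ _ _ mu lebesgue_measure W mW W0).
  rewrite -/M EFinM -muleA EFinD ge0_muleDl; last 2 first.
  + by [].
  + rewrite lee_fin mulr_ge0 ?subr_ge0//.
      by move: t0I; rewrite in_itv/= => /andP[]; exact: le_trans.
    by rewrite addr_ge0 ?mulr_ge0 ?sqr_ge0// ltW.
  rewrite mul1e; apply: leeD; first exact: integral_propag_sqr.
  apply: (@le_trans _ _ (\int[lebesgue_measure]_(s in `[al, be])
      ((k + k^-1 * L ^+ 2)%:E * (M%:E * I2)))%E).
    rewrite [leRHS]integral_mkcond; apply: ge0_le_integral => //.
    + by move=> s _; apply: integral_ge0.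
    + exact: measurable_fun_fubini_tonelli_G.
    + by apply/(measurable_restrictT _ _).1 => //; exact: measurable_cst.
    + move=> s _; rewrite patchE /W/= indicE; case: ifPn => _; last first.
        by rewrite integral0_eq// => x _; rewrite mulr0.
      by under eq_integral do rewrite mulr1; exact: Iw.
  have albe : al <= be by move: t0I; rewrite in_itv/= => /andP[]; exact: le_trans.
  have mI : (lebesgue_measure (`[al, be]%classic : set R) = (be - al)%:E)%E.
    rewrite lebesgue_measure_itv/= lte_fin.
    by move: albe; rewrite le_eqVlt => /predU1P[->|->]; rewrite ?ltxx ?subrr// EFinB.
  rewrite integral_cst//; set m := (X in (_ * X <= _)%E).
  rewrite (_ : m = (be - al)%:E); last exact: mI.
  by rewrite [leLHS]muleC [in leRHS]EFinM -[leRHS]muleA; exact: lexx.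
Qed.

End propagator.

(** * L^2 norms, energies and truncation *)

Local Open Scope complex_scope.

(** The integral of a nonnegative function is a supremum over the simple functions below it, and
    these only increase in number with the function. This is how the supremum in t is compared with
    its majorant. *)
Lemma ge0_le_integral_nonmeasurable d (T : measurableType d) (R : realType)
    (m : {measure set T -> \bar R}) (f g : T -> \bar R) :
  (forall x, 0 <= f x)%E -> (forall x, f x <= g x)%E ->
  (\int[m]_x f x <= \int[m]_x g x)%E.
Proof.
move=> f0 fg; have g0 x : (0 <= g x)%E by rewrite (le_trans (f0 x)).
rewrite !ge0_integralTE//; apply: le_ereal_sup => _ [h hf <-].
by exists h => // x; exact: le_trans (hf x) (fg x).
Qed.

Lemma normc_sqr (R : realType) (z : R[i]) :
  Normc.normc z ^+ 2 = complex.Re z ^+ 2 + complex.Im z ^+ 2.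
Proof. by case: z => a b /=; rewrite sqr_sqrtr// addr_ge0 ?sqr_ge0. Qed.

Lemma normc_ge0 (R : realType) (z : R[i]) : 0 <= Normc.normc z.
Proof. by case: z => a b; exact: sqrtr_ge0. Qed.

Section L2.
Context {R : realType} {N : nat}.
Local Notation mu := (lebesgue_Rn R N).
Local Notation X := 'R^(R, N).
Implicit Types (f g : X -> R[i]) (a b : X -> R).

(** The square of [L2norm f], written with real and imaginary parts so that the real estimates apply
    and square roots are postponed to the end. *)
Definition energy f : \bar R :=
  (\int[mu]_x (complex.Re (f x) ^+ 2 + complex.Im (f x) ^+ 2)%:E)%E.

Lemma energy_ge0 f : (0 <= energy f)%E.
Proof. by apply: integral_ge0 => x _; rewrite lee_fin addr_ge0 ?sqr_ge0. Qed.

Lemma energyE f : energy f = (\int[mu]_x (`|(Normc.normc (f x))%:E| `^ 2))%E.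
Proof.
apply: eq_integral => x _.
by rewrite -normc_sqr abse_EFin ger0_norm ?normc_ge0// poweR_EFin powR_mulrn ?normc_ge0.
Qed.

Lemma L2normE f : L2norm f = (energy f `^ 2^-1)%E.
Proof. by rewrite energyE /L2norm unlock. Qed.

Lemma L2norm_sqr f : (L2norm f `^ 2 = energy f)%E.
Proof. by rewrite energyE /L2norm powR_Lnorm. Qed.

Lemma measurable_eunorm : measurable_fun setT (@eunorm R N).
Proof.
apply: (@measurableT_comp _ _ _ _ _ _ (@Num.sqrt R)).
  by apply: continuous_measurable_fun; exact: sqrt_continuous.
by apply: measurable_sum => i; apply: measurable_funX; exact: measurable_tnthR.
Qed.

Lemma tnth_le_eunorm (x : X) i : `|tnth x i| <= eunorm x.
Proof.
rewrite -sqrtr_sqr ler_sqrt ?sumr_ge0// => [|j _]; last exact: sqr_ge0.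
by rewrite (bigD1 i)//= lerDl sumr_ge0// => j _; exact: sqr_ge0.
Qed.

Lemma measurable_eunorm_lt r : measurable (oball r : set X).
Proof.
have := measurable_eunorm measurableT (measurable_itv `]-oo, r[).
by rewrite setTI; congr measurable; apply/seteqP; split => x /=; rewrite in_itv.
Qed.

Lemma oball_lty r : (mu (oball r) < +oo)%E.
Proof.
pose B := [set x : X | forall i, `]- r, r[%classic (tnth x i)].
have mB : measurable B.
  rewrite (_ : B = \bigcap_(i in [set: 'I_N])
      ((fun x : X => tnth x i) @^-1` `]-r, r[)); last first.
    by apply/seteqP; split=> x /= h i => [_|]; exact: h.
  apply: fin_bigcap_measurable => // i _.
  by rewrite -[X in measurable X]setTI; exact: measurable_tnth.
apply: (@le_lt_trans _ _ (mu B)).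
  apply: le_measure; rewrite ?inE//; first exact: measurable_eunorm_lt.
  move=> x xr i /=; rewrite in_itv/= -ltr_norml.
  by rewrite (le_lt_trans (tnth_le_eunorm x i)).
pose A : set R := `]- r, r[%classic.
rewrite [mu B](lebesgue_Rn_box (A := fun=> A))//; last by move=> i; exact: measurable_itv.
suff : (\prod_(i < N) lebesgue_measure A)%E \is a fin_num.
  by move=> /fin_numPlt/andP[].
apply: (big_ind (fun z => z \is a fin_num)) => //.
  by move=> ? ? ? ?; exact: fin_numM.
by move=> i _; rewrite lebesgue_measure_itv/=; case: ifPn.
Qed.

(** On [D], |a| <= 1 + a^2, and both terms have a finite integral there. *)
Lemma integrable_trunc a (D : set X) : measurable D -> (mu D < +oo)%E ->
  measurable_fun setT a -> (\int[mu]_x (a x ^+ 2)%:E < +oo)%E ->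
  mu.-integrable setT (EFin \o (fun x => a x * \1_D x)).
Proof.
move=> mD Dy ma ay.
have i1 : mu.-integrable setT (fun x => (\1_D x)%:E).
  apply/integrableP; split; first by apply/measurable_EFinP; exact: measurable_indic.
  under eq_integral do rewrite /= ger0_norm//.
  by rewrite integral_indic// setIT.
have i2 : mu.-integrable setT (fun x => (a x ^+ 2)%:E).
  apply/integrableP; split; first by apply/measurable_EFinP; exact: measurable_funX.
  by under eq_integral do rewrite /= ger0_norm ?sqr_ge0//.
apply: le_integrable (integrableD measurableT i1 i2) => //.
  by apply/measurable_EFinP; apply: measurable_funM => //; exact: measurable_indic.
move=> x _ /=; rewrite lee_fin indicE; case: (x \in D); last by rewrite mulr0 normr0.
rewrite mulr1 [leRHS]ger0_norm ?addr_ge0 ?sqr_ge0// -(real_normK (num_real (a x))).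
set y := `|a x|; have := sqr_ge0 (y - 1); have := sqr_ge0 y; rewrite mulr1n; nra.
Qed.

Lemma trunc_sqr_le a b (D : set X) x :
  (a x * \1_D x) ^+ 2 + (b x * \1_D x) ^+ 2 <= a x ^+ 2 + b x ^+ 2.
Proof.
rewrite indicE; case: (x \in D); rewrite ?mulr1 ?mulr0//.
by rewrite expr0n/= addr0 addr_ge0 ?sqr_ge0.
Qed.

End L2.

(** * The Plancherel bound for the L^2 Fourier transform *)

Section fourier.
Context {R : realType} {N : nat}.
Local Notation mu := (lebesgue_Rn R N).
Local Notation X := 'R^(R, N).
Implicit Types (f g : X -> R[i]) (a b : X -> R) (r : R).

Lemma Re_sqr_le_energy f : (\int[mu]_x (complex.Re (f x) ^+ 2)%:E <= energy f)%E.
Proof.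
apply: ge0_le_integral_nonmeasurable => x; rewrite lee_fin ?sqr_ge0//.
by rewrite lerDl sqr_ge0.
Qed.

Lemma Im_sqr_le_energy f : (\int[mu]_x (complex.Im (f x) ^+ 2)%:E <= energy f)%E.
Proof.
apply: ge0_le_integral_nonmeasurable => x; rewrite lee_fin ?sqr_ge0//.
by rewrite lerDr sqr_ge0.
Qed.

Lemma memL2_energy f : memL2 f -> (energy f < +oo)%E.
Proof.
by move=> [_ _ fy]; rewrite -L2norm_sqr; exact: poweR_lty.
Qed.

Lemma measurable_propag_at (phi : X -> R) a b (t : R) : measurable_fun setT phi ->
  mu.-integrable setT (EFin \o a) -> mu.-integrable setT (EFin \o b) ->
  measurable_fun setT (propag phi a b t).
Proof.
move=> mphi ia ib.
have ma : measurable_fun setT a by apply/measurable_EFinP; exact: measurable_int ia.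
have mb : measurable_fun setT b by apply/measurable_EFinP; exact: measurable_int ib.
exact: (@measurable_fun_pair2 _ _ _ _ _ _
  (fun p : measurableTypeR R * X => propag phi a b p.1 p.2) t
  (measurable_propag mphi ma mb)).
Qed.

(** exp(- i x.xi) (a + i b) has real part cos a + sin b and imaginary part cos b - sin a. Both are
    integrands of [propag] with zero phase, so the forward transform inherits
    [integral_propag_sqr]. *)
Lemma fourier_integralE f r xi :
  let a x := complex.Re (f x) * \1_(oball r) x in
  let b x := complex.Im (f x) * \1_(oball r) x in
  fourier_integral (oball r) f xi = ((2 * pi) ^- N)%:C *
    (propag (cst 0) a (fun x => - b x) 0 xi +i* propag (cst 0) b a 0 xi).
Proof.
move=> a b; rewrite /fourier_integral /cintegral; congr (_ * (_ +i* _)).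
- rewrite Rintegral_mkcond; apply: eq_Rintegral => x _.
  rewrite patchE /a /b indicE mulr0 addr0 dotpC.
  case: ifPn => _; last by rewrite ?(mulr0, oppr0, subrr).
  rewrite !mulr1.
  case: (f x) => u v /=; rewrite cosN sinN.
  by ring.
- rewrite Rintegral_mkcond; apply: eq_Rintegral => x _.
  rewrite patchE /a /b indicE mulr0 addr0 dotpC.
  case: ifPn => _; last by rewrite ?(mulr0, oppr0, subrr).
  rewrite !mulr1.
  case: (f x) => u v /=; rewrite cosN sinN.
  by ring.
Qed.

(** The squared normalizing factor, times the constant [2 * (2 * pi) ^+ N] of [integral_propag_sqr]
    once for the real and once for the imaginary part. *)
Definition plancherel_const : R := ((2 * pi) ^- N) ^+ 2 * (4 * (2 * pi) ^+ N).

Lemma integrable_trunc_Re f (D : set X) : memL2 f -> measurable D ->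
  (mu D < +oo)%E -> mu.-integrable setT (EFin \o (fun x => complex.Re (f x) * \1_D x)).
Proof.
move=> mf mD Dy; have [mRe _ _] := mf; apply: integrable_trunc => //.
exact: le_lt_trans (Re_sqr_le_energy f) (memL2_energy mf).
Qed.

Lemma integrable_trunc_Im f (D : set X) : memL2 f -> measurable D ->
  (mu D < +oo)%E -> mu.-integrable setT (EFin \o (fun x => complex.Im (f x) * \1_D x)).
Proof.
move=> mf mD Dy; have [_ mIm _] := mf; apply: integrable_trunc => //.
exact: le_lt_trans (Im_sqr_le_energy f) (memL2_energy mf).
Qed.

Lemma measurable_fourier_integral f r : memL2 f ->
  measurable_fun setT (fun xi => complex.Re (fourier_integral (oball r) f xi)) /\
  measurable_fun setT (fun xi => complex.Im (fourier_integral (oball r) f xi)).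
Proof.
move=> mf.
have ia := integrable_trunc_Re mf (measurable_eunorm_lt r) (oball_lty r).
have ib := integrable_trunc_Im mf (measurable_eunorm_lt r) (oball_lty r).
have iNb : mu.-integrable setT (EFin \o (fun x => - (complex.Im (f x) * \1_(oball r) x))).
  by apply: eq_integrable (integrableN ib).
have mcst : measurable_fun setT (cst 0 : X -> R) by exact: measurable_cst.
split; under eq_fun do rewrite fourier_integralE/=.
  by apply: measurable_funB; apply: measurable_funM => //; exact: measurable_propag_at.
by apply: measurable_funD; apply: measurable_funM => //; exact: measurable_propag_at.
Qed.

Lemma energy_fourier_integral f r : memL2 f ->
  (energy (fourier_integral (oball r) f) <= plancherel_const%:E * energy f)%E.
Proof.
move=> mf.
pose a x := complex.Re (f x) * \1_(oball r) x.
pose b x := complex.Im (f x) * \1_(oball r) x.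
have ia : mu.-integrable setT (EFin \o a).
  exact: integrable_trunc_Re mf (measurable_eunorm_lt r) (oball_lty r).
have ib : mu.-integrable setT (EFin \o b).
  exact: integrable_trunc_Im mf (measurable_eunorm_lt r) (oball_lty r).
have iNb : mu.-integrable setT (EFin \o (fun x => - b x)).
  by apply: eq_integrable (integrableN ib).
pose k : R := (2 * pi) ^- N.
pose p := propag (cst 0) a (fun x => - b x) 0.
pose q := propag (cst 0) b a 0.
have mprop c d : mu.-integrable setT (EFin \o c) -> mu.-integrable setT (EFin \o d) ->
    measurable_fun setT (fun x => (propag (cst 0) c d 0 x ^+ 2)%:E).
  move=> ic id; apply/measurable_EFinP; apply: measurable_funX.
  exact: measurable_propag_at.
have -> : energy (fourier_integral (oball r) f) =
    ((k ^+ 2)%:E * (\int[mu]_x (p x ^+ 2)%:E + \int[mu]_x (q x ^+ 2)%:E))%E.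
  rewrite -ge0_integralD//; last 4 first.
  - by move=> x _; rewrite lee_fin sqr_ge0.
  - exact: mprop.
  - by move=> x _; rewrite lee_fin sqr_ge0.
  - exact: mprop.
  rewrite -ge0_integralZl//; last 3 first.
  - by apply: emeasurable_funD; exact: mprop.
  - by move=> x _; rewrite -EFinD lee_fin addr_ge0 ?sqr_ge0.
  - by rewrite lee_fin sqr_ge0.
  apply: eq_integral => x _; rewrite fourier_integralE -/a -/b -/p -/q -/k /=.
  by rewrite -EFinD -EFinM; congr EFin; ring.
have [pE qE] : (\int[mu]_x (p x ^+ 2)%:E <= (2 * (2 * pi) ^+ N)%:E * energy f)%E /\
    (\int[mu]_x (q x ^+ 2)%:E <= (2 * (2 * pi) ^+ N)%:E * energy f)%E.
  have mcst : measurable_fun setT (cst 0 : X -> R) by exact: measurable_cst.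
  have M0 : (0 <= (2 * (2 * pi) ^+ N : R)%:E)%E.
    by rewrite lee_fin mulr_ge0// exprn_ge0// mulr_ge0// pi_ge0.
  split.
    apply: le_trans (integral_propag_sqr mcst 0 ia iNb) _.
    apply: lee_wpmul2l => //; apply: ge0_le_integral_nonmeasurable => x.
      by rewrite lee_fin addr_ge0 ?sqr_ge0.
    by rewrite lee_fin sqrrN; exact: (trunc_sqr_le
      (fun x => complex.Re (f x)) (fun x => complex.Im (f x))).
  apply: le_trans (integral_propag_sqr mcst 0 ib ia) _.
  apply: lee_wpmul2l => //; apply: ge0_le_integral_nonmeasurable => x.
    by rewrite lee_fin addr_ge0 ?sqr_ge0.
  by rewrite lee_fin addrC; exact: (trunc_sqr_le
    (fun x => complex.Re (f x)) (fun x => complex.Im (f x))).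
apply: (@le_trans _ _ ((k ^+ 2)%:E *
  ((2 * (2 * pi) ^+ N)%:E * energy f + (2 * (2 * pi) ^+ N)%:E * energy f)))%E.
  by apply: lee_wpmul2l; [rewrite lee_fin sqr_ge0|exact: leeD].
have M0 : (0 <= (2 * (2 * pi) ^+ N : R)%:E)%E.
  by rewrite lee_fin mulr_ge0// exprn_ge0// mulr_ge0// pi_ge0.
rewrite -ge0_muleDl// muleA -EFinD -EFinM /plancherel_const -/k.
rewrite (_ : k ^+ 2 * _ = k ^+ 2 * (4 * (2 * pi) ^+ N))//.
by ring.
Qed.

Lemma plancherel_const_ge0 : 0 <= plancherel_const.
Proof.
by rewrite mulr_ge0 ?sqr_ge0// mulr_ge0// exprn_ge0// mulr_ge0// pi_ge0.
Qed.

Lemma energy_triangle f g : measurable_fun setT (fun x => complex.Re (f x)) ->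
  measurable_fun setT (fun x => complex.Im (f x)) ->
  measurable_fun setT (fun x => complex.Re (g x)) ->
  measurable_fun setT (fun x => complex.Im (g x)) ->
  (energy f <= 2%:E * (energy (fun x => f x - g x)%R + energy g))%E.
Proof.
move=> mfR mfI mgR mgI.
have ReB x : complex.Re (f x - g x) = complex.Re (f x) - complex.Re (g x).
  by case: (f x) (g x) => ? ? [].
have ImB x : complex.Im (f x - g x) = complex.Im (f x) - complex.Im (g x).
  by case: (f x) (g x) => ? ? [].
have m2 (u v : X -> R) : measurable_fun setT u -> measurable_fun setT v ->
   measurable_fun setT (fun x => (u x ^+ 2 + v x ^+ 2)%:E).
  move=> mu' mv; apply/measurable_EFinP.
  by apply: measurable_funD; exact: measurable_funX.
have mB : measurable_fun setT
    (fun x => (complex.Re (f x - g x) ^+ 2 + complex.Im (f x - g x) ^+ 2)%:E).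
  apply: m2.
    by under eq_fun do rewrite ReB; exact: measurable_funB.
  by under eq_fun do rewrite ImB; exact: measurable_funB.
rewrite /energy -ge0_integralD//; last 3 first.
- by move=> x _; rewrite lee_fin addr_ge0 ?sqr_ge0.
- by move=> x _; rewrite lee_fin addr_ge0 ?sqr_ge0.
- exact: m2.
rewrite -ge0_integralZl//; last 2 first.
- by apply: emeasurable_funD => //; exact: m2.
- by move=> x _; rewrite -EFinD lee_fin !addr_ge0 ?sqr_ge0.
apply: ge0_le_integral_nonmeasurable => x.
  by rewrite lee_fin addr_ge0 ?sqr_ge0.
rewrite -EFinD -EFinM lee_fin ReB ImB.
set u := complex.Re _; set v := complex.Im _.
set u' := complex.Re _; set v' := complex.Im _.
(* 2 ((u - u')^2 + u'^2) - u^2 = (u - 2 u')^2, and likewise for v. *)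
have := sqr_ge0 (u - 2 * u'); have := sqr_ge0 (v - 2 * v').
by nra.
Qed.

(** The bound for truncations is uniform in the radius. One radius with a small L^2 error is
    compared with g by [energy_triangle], which accounts for the extra factor 2. *)
Lemma energy_fourier_transform f g : memL2 f -> is_fourier_transform f g ->
  (energy g <= (2 * plancherel_const)%:E * energy f)%E.
Proof.
move=> mf [mg fg]; have [mgR mgI _] := mg.
apply/lee_addgt0Pr => e e0.
(* The error has energy at most e / 2, which the factor 2 of [energy_triangle] turns into e. *)
pose d := Num.sqrt (e / 2).
have d0 : 0 < d by rewrite sqrtr_gt0 divr_gt0.
have /fine_cvgP[fin_fg cvg_fg] := fg.
move/cvgr0_norm_lt : cvg_fg => /(_ _ d0) near_fg.
have [r [r_fin r_lt]] := filter_ex (filterI fin_fg near_fg).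
set F := fourier_integral (oball r) f.
have [mFR mFI] := measurable_fourier_integral r mf.
apply: le_trans (energy_triangle mgR mgI mFR mFI) _.
have small : (energy (fun x => g x - F x)%R <= (e / 2)%:E)%E.
  rewrite -L2norm_sqr -(fineK r_fin) poweR_EFin lee_fin powR_mulrn ?fine_ge0//.
    rewrite -[leRHS]sqr_sqrtr ?divr_ge0 ?(ltW e0)//.
    rewrite lerXn2r ?nnegrE ?fine_ge0 ?Lnorm_ge0 ?(ltW d0)//.
    by rewrite (le_trans (ler_norm _))// ltW.
  exact: Lnorm_ge0.
apply: (@le_trans _ _ (2%:E * ((e / 2)%:E + plancherel_const%:E * energy f)))%E.
  by apply: lee_wpmul2l => //; apply: leeD => //; exact: energy_fourier_integral.
rewrite muleDr ?fin_num_adde_defr// addeC -EFinM muleA -EFinM.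
by rewrite (mulrC 2 (e / 2)) divfK.
Qed.

End fourier.

(** * Essential support, and the propagator as real integrals *)

Section support.
Context {R : realType} {N : nat}.
Local Notation mu := (lebesgue_Rn R N).
Local Notation X := 'R^(R, N).

Lemma eudist_lt (x y : X) (d r : R) : 0 <= d ->
  (forall i, `|tnth x i - tnth y i| <= d) -> N.+1%:R * d < r -> eudist x y < r.
Proof.
move=> d0 xyd dr; apply: le_lt_trans dr.
rewrite -[leRHS]ger0_norm ?mulr_ge0// -sqrtr_sqr ler_sqrt ?sqr_ge0//.
apply: (@le_trans _ _ (\sum_(i < N) d ^+ 2)).
  apply: ler_sum => i _; rewrite -(real_normK (num_real (_ - _))).
  by rewrite lerXn2r ?nnegrE.
rewrite sumr_const card_ord -[leLHS]mulr_natl exprMn ler_wpM2r ?sqr_ge0//.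
rewrite -natrX ler_nat expnS expn1.
by rewrite (leq_trans (leqnSn N))// leq_pmull.
Qed.

(* Lindelof: countably many rational cubes suffice to cover the complement. *)
Lemma ae_zero_off_esupport (g : X -> R[i]) :
  {ae mu, forall x, ~ esupport g x -> g x = 0}.
Proof.
pose Q (p : N.-tuple rat * nat) : set X :=
  [set x | forall i, `|tnth x i - ratr (tnth p.1 i)| < p.2.+1%:R^-1].
pose Good p := {ae mu, forall x, Q p x -> g x = 0}.
pose B p := [set x | [/\ Good p, Q p x & g x <> 0]].
have negB p : mu.-negligible (B p).
  have [Gp|nGp] := pselect (Good p); last first.
    by apply: negligibleS (negligible_set0 mu) => x [].
  by apply: negligibleS Gp => x [_ Qx gx] H; apply: gx; exact: H.
pose F n := if unpickle n is Some p then B p else set0.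
have negF : mu.-negligible (\bigcup_n F n).
  apply: negligible_bigcup => n; rewrite /F; case: unpickle => [p|]; first exact: negB.
  exact: negligible_set0.
apply: negligibleS negF => x /= /not_implyP[nsx gx].
move/existsNP : nsx => [r /not_implyP[r0 /contrapT aer]].
(* Two points of a cube of half-side [dk] differ by less than [2 * dk] in each coordinate; this [k]
   makes the cube around a rational point near x fit into the ball of radius r at x. *)
pose k := Num.bound (N.+1%:R * 2 / r : R).
pose dk : R := k.+1%:R^-1.
have dk0 : 0 < dk by rewrite invr_gt0.
have kr : N.+1%:R * (2 * dk) < r.
  have : N.+1%:R * 2 / r < k.+1%:R.
    by rewrite (lt_trans (archi_boundP _))// ?ltr_nat// divr_ge0// ltW.
  by rewrite ltr_pdivrMr// /dk mulrA ltr_pdivrMr// [ltRHS]mulrC.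
have /choice[q Hq] (i : 'I_N) : exists q : rat, `|tnth x i - ratr q| < dk.
  have /rat_in_itvoo[q] : tnth x i - dk < tnth x i + dk by lra.
  rewrite in_itv/= => /andP[q1 q2]; exists q; rewrite ltr_distlC.
  by apply/andP; split; lra.
pose p := ([tuple q i | i < N], k).
have Qx : Q p x by move=> i /=; rewrite tnth_mktuple.
exists (pickle p) => //; rewrite /F pickleK; split => //.
apply: filterS aer => y aey Qy; apply: aey.
apply: (@eudist_lt x y (2 * dk)) => //; first by rewrite mulr_ge0// ltW.
move=> i.
have := Qx i; have := Qy i => /=; rewrite tnth_mktuple => h1 h2.
rewrite (_ : tnth x i - tnth y i =
  (tnth x i - ratr (q i)) - (tnth y i - ratr (q i))); last by ring.
rewrite (le_trans (ler_normB _ _))// mulr_natl mulr2n lerD//; exact: ltW.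
Qed.

Lemma symbol_le (s : 'I_N -> bool) (xi : X) : `|symbol s xi| <= eunorm xi ^+ 2.
Proof.
rewrite sqr_sqrtr ?sumr_ge0// => [|i _]; last exact: sqr_ge0.
apply: le_trans (ler_norm_sum _ _ _) _; apply: ler_sum => i _.
by rewrite normrM normrX normrN1 expr1n mul1r ger0_norm ?sqr_ge0.
Qed.

Lemma measurable_symbol (s : 'I_N -> bool) : measurable_fun setT (@symbol R N s).
Proof.
apply: measurable_sum => i; apply: measurable_funM => //.
by apply: measurable_funX; exact: measurable_tnthR.
Qed.

(** Cutting g off to [D] alters the integrands only on a null set. The phase bound of [band_limited]
    is required at every point, and the cut-off data can satisfy it everywhere. *)
Lemma eitL_propag (s : 'I_N -> bool) (g : X -> R[i]) (D : set X) (t : R) (x : X) :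
  measurable D ->
  measurable_fun setT (fun xi => complex.Re (g xi)) ->
  measurable_fun setT (fun xi => complex.Im (g xi)) ->
  {ae mu, forall xi, ~ D xi -> g xi = 0} ->
  let a xi := complex.Re (g xi) * \1_D xi in
  let b xi := complex.Im (g xi) * \1_D xi in
  eitL s g t x = propag (symbol s) a b t x +i* propag (symbol s) b (fun xi => - a xi) t x.
Proof.
move=> mD mR mI g0 a b.
have mp : measurable_fun setT (fun xi => dotp x xi + t * symbol s xi).
  apply: measurable_funD; first exact: measurable_dotp.
  by apply: measurable_funM => //; exact: measurable_symbol.
have mc := measurableT_comp measurable_cosR mp.
have ms := measurableT_comp measurable_sinR mp.
have ma : measurable_fun setT a.
  by apply: measurable_funM => //; exact: measurable_indic.
have mb : measurable_fun setT b.
  by apply: measurable_funM => //; exact: measurable_indic.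
have ReE z xi : complex.Re (cis z * g xi) =
    cos z * complex.Re (g xi) - sin z * complex.Im (g xi).
  by rewrite /cis; case: (g xi).
have ImE z xi : complex.Im (cis z * g xi) =
    cos z * complex.Im (g xi) + sin z * complex.Re (g xi).
  by rewrite /cis; case: (g xi).
rewrite /eitL /cintegral; congr (_ +i* _); congr fine.
- under eq_integral do rewrite ReE.
  apply: ae_eq_integral => //.
  + by apply/measurable_EFinP; apply: measurable_funB; apply: measurable_funM.
  + by apply/measurable_EFinP; apply: measurable_funB; apply: measurable_funM.
  + apply: filterS g0 => xi g0 _; rewrite /a /b indicE.
    have [/set_mem Dx|/negP nDx] := boolP (xi \in D); first by rewrite !mulr1.
    by rewrite g0 ?mulr0 ?mul0r ?mulr0// => Dx; apply: nDx; exact/mem_set.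
- under eq_integral do rewrite ImE.
  apply: ae_eq_integral => //.
  + by apply/measurable_EFinP; apply: measurable_funD; apply: measurable_funM.
  + apply/measurable_EFinP; apply: measurable_funB; apply: measurable_funM => //.
    exact: measurable_funN.
  + apply: filterS g0 => xi g0 _; rewrite /a /b indicE.
    have [/set_mem Dx|/negP nDx] := boolP (xi \in D); first by rewrite !mulr1 mulrN opprK.
    rewrite g0 ?mulr0 ?mul0r ?mulr0 ?oppr0 ?mulr0 ?subr0 ?addr0// => Dx.
    by apply: nDx; exact/mem_set.
Qed.

End support.

(** * The maximal estimate on an interval *)

(** Positive measure excludes the empty interval and finite measure the unbounded ones; closing the
    remaining ones does not change their length. *)
Lemma bounded_itv_lebesgue (R : realType) (I : interval R) (l : R) : 0 < l ->
  lebesgue_measure [set` I] = l%:E ->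
  exists al be t0 : R, [/\ be - al = l, t0 \in I & {subset I <= `[al, be]}].
Proof.
move=> l0 Il.
have [I0|/set0P[t0 It0]] := eqVneq [set` I] set0.
  by move: Il; rewrite I0 measure0 => -[l00]; move: l0; rewrite -l00 ltxx.
move: Il; rewrite lebesgue_measure_itv.
have l_neq0 : 0%E = l%:E -> False by move=> -[l00]; move: l0; rewrite -l00 ltxx.
case: I It0 => [[b x|[]] [b' y|[]]] It0 //=.
- case: ifPn => [_ [xyl]|_ e0]; last by case: (l_neq0 e0).
  exists x, y, t0; split => //.
  by apply/subitvP; rewrite subitvE !bnd_simp; case: b b' {It0} => [] [].
- by rewrite ltry.
- by rewrite ltNyr.
Qed.

Lemma EFin_sqrt (R : realType) (x : R) : 0 <= x -> (x%:E `^ 2^-1 = (Num.sqrt x)%:E)%E.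
Proof. by move=> x0; rewrite poweR_EFin powR12_sqrt. Qed.

Lemma sqr_poweR12 (R : realType) (x : \bar R) : (0 <= x)%E -> ((x `^ 2^-1) `^ 2 = x)%E.
Proof. by move=> x0; rewrite -poweRrM mulVf// poweRe1. Qed.

Theorem theorem1p10 (R : realType) (N : nat) (c1 c2 : R) :
  (2 <= N)%N -> 0 < c1 -> c1 < c2 ->
  exists C : R,
    forall (s : 'I_N -> bool) (lambda : R) (f fhat : 'R^(R, N) -> R[i])
      (I : interval R),
    admissible_signs s ->
    1 <= lambda ->
    memL2 f ->
    is_fourier_transform f fhat ->
    esupport fhat `<=`
      [set xi | c1 * lambda <= eunorm xi /\ eunorm xi <= c2 * lambda] ->
    ((lambda ^- 2)%:E <= lebesgue_measure [set` I])%E ->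
    (lebesgue_measure [set` I] <= (lambda^-1)%:E)%E ->
    ('N[lebesgue_Rn R N]_2%:E
       [(fun x => ereal_sup
          [set (Normc.normc (eitL s fhat t x))%:E | t in [set` I]])
        \_ (oball 1%R)]
     <= C%:E * lambda%:E * lebesgue_measure [set` I] `^ (2^-1)%R * L2norm f)%E.
Proof.
move=> _ c10 c12.
pose M : R := 2 * (2 * pi) ^+ N.
have M0 : 0 <= M by rewrite mulr_ge0// exprn_ge0// mulr_ge0// pi_ge0.
(* The 2 counts real and imaginary parts, and [M] is the constant of [integral_propag_sqr]. With L^2
   = c2^4 lambda^4 and 1 <= l lambda^2, the sum 1 + l (lambda^2 + lambda^-2 L^2) is at most (2 +
   c2^4) l lambda^2. The last factor bounds the energy of fhat by that of f. *)
pose K : R := 2 * M * (2 + c2 ^+ 4) * (2 * plancherel_const (R := R) (N := N)).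
have K0 : 0 <= K.
  apply: mulr_ge0; last by rewrite mulr_ge0// plancherel_const_ge0.
  by apply: mulr_ge0; [exact: mulr_ge0|rewrite addr_ge0// exprn_even_ge0].
exists (Num.sqrt K) => s lambda f g I _ l1 mf fg supp Ilo Ihi.
have c20 : 0 < c2 by exact: lt_trans c12.
have l0 : 0 < lambda by rewrite (lt_le_trans ltr01).
have [l IlE] : exists l, lebesgue_measure [set` I] = l%:E.
  exists (fine (lebesgue_measure [set` I])); rewrite fineK// ge0_fin_numE//.
  by rewrite (le_lt_trans Ihi)// ltry.
rewrite IlE in Ilo Ihi *; rewrite lee_fin in Ilo.
have llo : 0 < l by rewrite (lt_le_trans _ Ilo)// invr_gt0 exprn_gt0.
have l2 : 1 <= l * lambda ^+ 2.
  by rewrite -ler_pdivrMr ?exprn_gt0// div1r.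
have [al [be [t0 [beal t0I Isub]]]] := bounded_itv_lebesgue llo IlE.
pose phi := @symbol R N s.
have mphi : measurable_fun setT phi by exact: measurable_symbol.
pose L := (c2 * lambda) ^+ 2.
have L0 : 0 < L by rewrite exprn_gt0// mulr_gt0.
pose D := [set xi : 'R^(R, N) | eunorm xi <= c2 * lambda].
have mD : measurable D.
  have := @measurable_eunorm R N measurableT _ (measurable_itv `]-oo, c2 * lambda]).
  by rewrite setTI; congr measurable; apply/seteqP; split => x /=; rewrite in_itv.
have Dy : (lebesgue_Rn R N D < +oo)%E.
  apply: le_lt_trans (oball_lty (c2 * lambda + 1)).
  apply: le_measure; rewrite ?inE//; first exact: measurable_eunorm_lt.
  by move=> x /= xD; rewrite /oball/= (le_lt_trans xD)// ltrDl.
have [mg _] := fg; have [mgR mgI _] := mg.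
have gD : {ae lebesgue_Rn R N, forall xi, ~ D xi -> g xi = 0}.
  apply: filterS (ae_zero_off_esupport g) => xi + nD; apply.
  by move=> /supp[_ /nD].
pose a xi := complex.Re (g xi) * \1_D xi.
pose b xi := complex.Im (g xi) * \1_D xi.
have LD (u : 'R^(R, N) -> R) xi : `|phi xi * (u xi * \1_D xi)| <= L * `|u xi * \1_D xi|.
  rewrite normrM indicE.
  have [/set_mem Dx|_] := boolP (xi \in D); last by rewrite !mulr0 normr0 !mulr0.
  rewrite ler_wpM2r// (le_trans (symbol_le _ _))// lerXn2r ?nnegrE ?sqrtr_ge0//.
  by rewrite mulr_ge0 ?ltW.
have ba : band_limited phi L a by split; [exact: integrable_trunc_Re|exact: LD].
have bb : band_limited phi L b by split; [exact: integrable_trunc_Im|exact: LD].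
have bNa := band_limitedN ba.
have k0 : 0 < lambda ^+ 2 by rewrite exprn_gt0.
have t0al := Isub _ t0I.
have [H1 [mH1 H10 H1P H1I]] := maximal_propag mphi L0 ba bb k0 t0al.
have [H2 [mH2 H20 H2P H2I]] := maximal_propag mphi L0 bb bNa k0 t0al.
pose H x := (H1 x + H2 x)%E.
have H0 x : (0 <= H x)%E by rewrite adde_ge0.
have sup_le x t : t \in I -> ((Normc.normc (eitL s g t x) ^+ 2)%:E <= H x)%E.
  move=> tI; rewrite normc_sqr (eitL_propag _ _ _ mD mgR mgI gD)/= EFinD.
  by apply: leeD; [apply: H1P; exact: Isub|apply: H2P; exact: Isub].
pose B : \bar R := ((K * lambda ^+ 2 * l)%:E * energy f)%E.
have HB : (\int[lebesgue_Rn R N]_x H x <= B)%E.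
  rewrite ge0_integralD//.
  have gf := energy_fourier_transform mf fg.
  pose A : R := (1 + (be - al) * (lambda ^+ 2 + (lambda ^+ 2)^-1 * L ^+ 2)) * M.
  have A0 : 0 <= A.
    rewrite mulr_ge0// addr_ge0// mulr_ge0 ?beal ?(ltW llo)// addr_ge0 ?(ltW k0)//.
    by rewrite mulr_ge0 ?invr_ge0 ?(ltW k0)// sqr_ge0.
  have AK : 2 * A * (2 * plancherel_const (R := R) (N := N)) <= K * lambda ^+ 2 * l.
    rewrite /K /A beal.
    rewrite (_ : (lambda ^+ 2)^-1 * L ^+ 2 = c2 ^+ 4 * lambda ^+ 2); last first.
      by rewrite /L; field; rewrite gt_eqF.
    have P0 : 0 <= 2 * plancherel_const (R := R) (N := N).
      by rewrite mulr_ge0// plancherel_const_ge0.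
    set P := 2 * plancherel_const in P0 *.
    rewrite (_ : 2 * M * (2 + c2 ^+ 4) * P * lambda ^+ 2 * l =
      2 * ((2 + c2 ^+ 4) * (l * lambda ^+ 2) * M) * P); last by ring.
    rewrite ler_wpM2r// ler_wpM2l// ler_wpM2r//.
    rewrite (_ : (2 + c2 ^+ 4) * (l * lambda ^+ 2) =
      l * lambda ^+ 2 + l * (lambda ^+ 2 + c2 ^+ 4 * lambda ^+ 2)); last by ring.
    by rewrite lerD2r.
  have sqrg x : a x ^+ 2 + b x ^+ 2 <= complex.Re (g x) ^+ 2 + complex.Im (g x) ^+ 2.
    exact: (trunc_sqr_le (fun x => complex.Re (g x)) (fun x => complex.Im (g x))).
  have H1E : (\int[lebesgue_Rn R N]_x H1 x <= A%:E * energy g)%E.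
    apply: le_trans H1I _; apply: lee_wpmul2l; first by rewrite lee_fin.
    by apply: ge0_le_integral_nonmeasurable => x; rewrite lee_fin ?addr_ge0 ?sqr_ge0.
  have H2E : (\int[lebesgue_Rn R N]_x H2 x <= A%:E * energy g)%E.
    apply: le_trans H2I _; apply: lee_wpmul2l; first by rewrite lee_fin.
    apply: ge0_le_integral_nonmeasurable => x; rewrite lee_fin ?addr_ge0 ?sqr_ge0//.
    by rewrite sqrrN addrC.
  apply: le_trans (leeD H1E H2E) _.
  rewrite -ge0_muleDl ?lee_fin// -EFinD.
  apply: (@le_trans _ _ ((A + A)%:E *
      ((2 * plancherel_const (R := R) (N := N))%:E * energy f)))%E.
    by apply: lee_wpmul2l => //; rewrite lee_fin addr_ge0.
  rewrite muleA -EFinM; apply: lee_wpmul2r; first exact: energy_ge0.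
  rewrite lee_fin; apply: le_trans AK; rewrite le_eqVlt; apply/orP; left; apply/eqP; ring.
have Kl0 : 0 <= K * lambda ^+ 2 * l.
  by apply: mulr_ge0; [apply: mulr_ge0 => //; exact: ltW|exact: ltW].
(* Both sides of the goal become square roots, leaving a comparison of integrals of squares. *)
have -> : ((Num.sqrt K)%:E * lambda%:E * l%:E `^ 2^-1 * L2norm f = B `^ 2^-1)%E.
  rewrite L2normE poweRM ?energy_ge0 ?lee_fin// EFin_sqrt ?(ltW llo)// EFin_sqrt//.
  rewrite -!EFinM; congr (_%:E * _)%E.
  rewrite (sqrtrM l (mulr_ge0 K0 (ltW k0))) (sqrtrM (lambda ^+ 2) K0).
  by rewrite sqrtr_sqr gtr0_norm.
rewrite unlock.
apply: gt0_ler_poweR.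
- by rewrite invr_ge0.
- by rewrite in_itv/= integral_ge0 ?leey// => x _; exact: poweR_ge0.
- by rewrite in_itv/= leey andbT; apply: mule_ge0; [rewrite lee_fin|exact: energy_ge0].
apply: le_trans HB; apply: ge0_le_integral_nonmeasurable => x; first exact: poweR_ge0.
(* The majorant is controlled on the whole space, so outside the unit ball it is compared with 0. *)
rewrite patchE; case: ifPn => _; last by rewrite abse0 poweR0r.
set S := ereal_sup _.
(* The point [t0] of the interval is essential here: the supremum of an empty set would be -oo. *)
have S0 : (0 <= S)%E.
  apply: (@le_trans _ _ (Normc.normc (eitL s g t0 x))%:E).
    by rewrite lee_fin normc_ge0.
  by apply: ereal_sup_ubound; exists t0.
rewrite gee0_abs// -(sqr_poweR12 (H0 x)).
apply: gt0_ler_poweR => //.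
- by rewrite in_itv/= S0 leey.
- by rewrite in_itv/= poweR_ge0 leey.
apply: ge_ereal_sup => _ [t tI <-].
rewrite -[X in X%:E]ger0_norm ?normc_ge0// -sqrtr_sqr -EFin_sqrt ?sqr_ge0//.
apply: gt0_ler_poweR.
- by rewrite invr_ge0.
- by rewrite in_itv/= lee_fin sqr_ge0 leey.
- by rewrite in_itv/= H0 leey.
exact: sup_le.
Qed.
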